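(* Consider the downlink (DL) channel vector $\mathbf h^d(t_p)\in\mathbb C^{N_tN_f\times1}$ and its reconstruction $\widetilde{\mathbf h}^d(t_p)=\widetilde{\mathbf h}_1^d(t_p)+\widetilde{\mathbf h}_2^d(t_p)$ by the joint angle-delay-Doppler framework described in the context, with $N_s$ selected angle-delay vectors, $M$ Doppler poles per angle-delay vector, matrix-pencil prediction order $L$, $N_L$ uplink channel samples and noise power $\sigma^2$. Let $$\bar\varepsilon=\mathbb E\left\{\left\|\frac{\mathbf h^d(t_p)-\widetilde{\mathbf h}^d(t_p)}{\mathbf h^d(t_p)}\right\|_2^2\right\}$$ be the channel prediction error. Then for any $L$ satisfying $M\le L\le N_L-L$, $$\mathbb E\left\{\left\|\frac{\mathbf h^d(t_p)-\widetilde{\mathbf h}_1^d(t_p)}{\mathbf h^d(t_p)}\right\|_2^2\right\}-\mathbb E\left\{\frac{N_sM\sigma^2}{\|\mathbf h^d(t_p)\|_2^2}\right\}\le\bar\varepsilon\le\mathbb E\left\{\left\|\frac{\mathbf h^d(t_p)-\widetilde{\mathbf h}_1^d(t_p)}{\mathbf h^d(t_p)}\right\|_2^2\right\}+\mathbb E\left\{\frac{N_sM\sigma^2}{\|\mathbf h^d(t_p)\|_2^2}\right\}.$$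
   Context: Notation: $j$ in exponents is the imaginary unit, $\otimes$ the Kronecker product, $(\cdot)^T,(\cdot)^H,(\cdot)^\dagger$ the transpose, conjugate transpose and Moore-Penrose inverse. The quotient notation $\left\|\frac{\mathbf x}{\mathbf y}\right\|_2^2$ for vectors means $\|\mathbf x\|_2^2/\|\mathbf y\|_2^2$. Channel model. The base station (BS) has a uniform planar array of $N_t=N_vN_h$ antennas with vertical/horizontal spacings $l_v,l_h$; there are $N_f$ subcarriers with spacing $f_\Delta$; $f^u,f^d$ are the uplink (UL) and DL center frequencies; $c$ is the speed of light. There are $P$ paths; path $p$ has zenith angle $\theta_p$, azimuth angle $\phi_p$, delay $\tau_p$ (all equal in UL and DL), complex amplitudes $\beta_p^u,\beta_p^d$, and Doppler shifts $w_p^u,w_p^d$ with $w_p^u/w_p^d=f^u/f^d$. Put $\boldsymbol\alpha_h^u(\theta,\phi)=[e^{j2\pi \frac{l_hf^u}{c}n\cos\theta\cos\phi}]_{n=0}^{N_h-1}$, $\boldsymbol\alpha_v^u(\theta)=[e^{j2\pi\frac{l_vf^u}{c}n\cos\theta}]_{n=0}^{N_v-1}$ (column vectors), $\boldsymbol\alpha^u=\boldsymbol\alpha_h^u\otimes\boldsymbol\alpha_v^u$. The rotation matrices are the diagonal matrices $\mathbf R_h(\theta,\phi)=\mathrm{diag}(e^{j2\pi n\frac{l_h(f^d-f^u)}{c}\cos\theta\cos\phi})_{n=0}^{N_h-1}$, $\mathbf R_v(\theta)=\mathrm{diag}(e^{j2\pi n\frac{l_v(f^d-f^u)}{c}\cos\theta})_{n=0}^{N_v-1}$,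 $\mathbf R(\theta,\phi)=\mathbf R_h(\theta,\phi)\otimes\mathbf R_v(\theta)$, and $\boldsymbol\alpha^d=\mathbf R\,\boldsymbol\alpha^u$. The delay vector is $\mathbf c(\tau)=e^{-j2\pi f^uf_\Delta\tau}[1,\dots,e^{-j2\pi\tau(N_f-1)f_\Delta}]^T$. The angle-delay structures of path $p$ are $\mathbf r_p^u=\mathbf c(\tau_p)\otimes\boldsymbol\alpha^u(\theta_p,\phi_p)$ and $\mathbf r_p^d=\mathbf c(\tau_p)\otimes\boldsymbol\alpha^d(\theta_p,\phi_p)$. The vectorized channels are $$\mathbf h^u(t)=\sum_{p=1}^P\beta_p^ue^{-j2\pi f^u\tau_p}e^{jw_p^ut}\mathbf r_p^u,\qquad \mathbf h^d(t)=\sum_{p=1}^P\beta_p^de^{-j2\pi f^d\tau_p}e^{jw_p^dt}\mathbf r_p^d .$$ The prediction time is $t_p=t+T_d$, where $T_d$ is the channel state information delay, during which the channel parameters (angles, delays, Doppler shifts) are assumed unchanged. UL parameter extraction. Let $\mathbf W(X)$ be the $X\times X$ matrix with entries $X^{-1/2}e^{j2\pi ab/X}$, $0\le a,b\le X-1$, and $\mathbf Q=\mathbf W(N_f)^H\otimes\mathbf W(N_h)\otimes\mathbf W(N_v)$ with columns $\mathbf q_i$. Put $\hat g_i^u(t)=\mathbf q_i^H\mathbf h^u(t)$. From $N_L$ UL channel samples at $t_1,\dots,t_{N_L}$ an index set $\mathcal S$ of $N_s$ columns is selected, as a smallest set with $\sum_{l=1}^{N_L}\sum_{i\in\mathcal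 S}|\hat g_i^u(t_l)|^2\ge\eta\sum_{l=1}^{N_L}\|\mathbf Q^H\mathbf h^u(t_l)\|_2^2$ for a power threshold $\eta$. For each $i\in\mathcal S$ one fits $\hat g_i^u(t)=\sum_{m=1}^Ma_m^u(i)(z_m^u(i))^t$ by the matrix pencil method of prediction order $L$: the poles $z_m^u(i)$ are the eigenvalues of $\mathbf P_0(i)^\dagger\mathbf P_1(i)$, where $\mathbf P_1(i),\mathbf P_0(i)$ are the $(N_L-L)\times L$ matrices with $(a,b)$ entries $\hat g_i^u(t_{L+1+a-b})$ and $\hat g_i^u(t_{L+a-b})$ respectively. DL reconstruction. Write $\mathcal S=\{i_{s_1},\dots,i_{s_{N_s}}\}$ and $\mathbf u_j=\mathbf q_{i_{s_j}}$. The DL angle-delay vectors are $\mathbf d_j=(\mathbf I_{N_f}\otimes\mathbf R(\theta_j,\phi_j))\mathbf u_j$, where $(\theta_j,\phi_j)$ are the angles associated with the column index $i=i_{s_j}$ by $\sin\theta_j\sin\phi_j=\frac{i^hc}{l_hf^uN_h}$, $\cos\theta_j=\frac{c\,i^v}{l_vf^uN_v}$; here $i^a\in\{1,\dots,N_t\}$ is congruent to $i$ modulo $N_t$, $i^v\in\{1,\dots,N_v\}$ is congruent to $i^a$ modulo $N_v$, and $i^h=(i^a-i^v)/N_v+1$. The DL Doppler factors are $e^{jw_m^d(j)}=\exp\!\big(j\arccos(\Re\{z_m^u(i)/|z_m^u(i)|\})f^d/f^u\big)$ with $i=i_{s_j}$. Let $\mathbf D=[\mathbf d_1,\dots,\mathbf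 d_{N_s}]$ and let $\mathbf E(t)\in\mathbb C^{N_s\times N_sM}$ be block diagonal with row blocks $\mathbf e_j(t)=[e^{jw_1^d(j)t},\dots,e^{jw_M^d(j)t}]$. With a unitary pilot matrix $\mathbf S\in\mathbb C^{N_sM\times N_sM}$ and receiver noise $\mathbf n(t_p)\in\mathbb C^{1\times N_sM}$, $\mathbf n(t_p)\sim\mathcal{CN}(0,\sigma^2\mathbf I)$, the reconstructed DL channel is expressed as $$\widetilde{\mathbf h}^d(t_p)=\widetilde{\mathbf h}_1^d(t_p)+\widetilde{\mathbf h}_2^d(t_p),\quad \widetilde{\mathbf h}_1^d(t_p)=\mathbf D\mathbf D^\dagger\mathbf h^d(t_p),\quad \widetilde{\mathbf h}_2^d(t_p)=\mathbf D\mathbf E(t_p)(\mathbf S^\dagger)^T\mathbf n(t_p)^T.$$ *)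

(* Defs.v *)
From HB Require Import structures.
From mathcomp Require Import all_boot all_order all_algebra.
From mathcomp Require Import all_classical all_reals all_analysis.
From mathcomp Require Import complex mxtens spectral.

Set Implicit Arguments.
Unset Strict Implicit.
Unset Printing Implicit Defensive.

Import Order.TTheory GRing.Theory Num.Theory.

Local Open Scope classical_set_scope.
Local Open Scope ring_scope.
Local Open Scope complex_scope.
Local Open Scope sesquilinear_scope.

Definition expi (R : realType) (x : R) : R[i] := cos x +i* sin x.

(* The squared Euclidean norm, as an element of R rather than of R[i]. *)
Definition sqnorm (R : realType) n (x : 'cV[R[i]]_n) : R :=
  \sum_(k < n) complex.Re `|x k 0| ^+ 2.

Definition penrose (R : realType) m n (A : 'M[R[i]]_(m, n))
    (X : 'M[R[i]]_(n, m)) : Prop :=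
  [/\ A *m X *m A = A, X *m A *m X = X,
      (A *m X)^t* = A *m X & (X *m A)^t* = X *m A].

(* The Moore-Penrose inverse: exactly one matrix satisfies [penrose A], so the
   default value 0 of [xget] is never used. *)
Definition mpinv (R : realType) m n (A : 'M[R[i]]_(m, n)) : 'M[R[i]]_(n, m) :=
  xget 0 [set X | penrose A X].

Definition kron_cV (R : realType) m n (x : 'cV[R[i]]_m) (y : 'cV[R[i]]_n) :
  'cV[R[i]]_(m * n) := x *t y.

Definition dftmx (R : realType) (X : nat) : 'M[R[i]]_X :=
  \matrix_(a < X, b < X)
    ((Num.sqrt X%:R)^-1%:C * expi (2 * pi * (a * b)%:R / X%:R)).

Record ofdm_system (R : realType) := OfdmSystem {
  Nv : nat; Nh : nat; Nf : nat;  (* antennas (vertical, horizontal), subcarriers *)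
  lv : R; lh : R;                (* vertical and horizontal antenna spacings *)
  fdelta : R;                    (* subcarrier spacing *)
  fu : R; fd : R;                (* uplink and downlink center frequencies *)
  cel : R;                       (* speed of light *)
  Nv_gt0 : (0 < Nv)%N; Nh_gt0 : (0 < Nh)%N; Nf_gt0 : (0 < Nf)%N;
  lv_gt0 : 0 < lv; lh_gt0 : 0 < lh; fdelta_gt0 : 0 < fdelta;
  fu_gt0 : 0 < fu; fd_gt0 : 0 < fd; cel_gt0 : 0 < cel }.

Record path_param (R : realType) := PathParam {
  zenith : R; azimuth : R; delay : R;
  beta_u : R[i]; beta_d : R[i];      (* uplink and downlink amplitudes *)
  doppler_u : R; doppler_d : R }.

Section Channel.
Context (R : realType) (s : ofdm_system R).
Implicit Types theta phi tau t : R.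

Definition Nt : nat := (Nh s * Nv s)%N.
Definition Ndim : nat := (Nf s * Nt)%N.

Definition steer_h_u theta phi : 'cV[R[i]]_(Nh s) :=
  \col_n expi (2 * pi * (lh s * fu s / cel s) * n%:R * cos theta * cos phi).

Definition steer_v_u theta : 'cV[R[i]]_(Nv s) :=
  \col_n expi (2 * pi * (lv s * fu s / cel s) * n%:R * cos theta).

Definition steer_u theta phi : 'cV[R[i]]_Nt :=
  kron_cV (steer_h_u theta phi) (steer_v_u theta).

Definition rot_h theta phi : 'M[R[i]]_(Nh s) :=
  diag_mx (\row_n expi (2 * pi * n%:R * (lh s * (fd s - fu s) / cel s)
                        * cos theta * cos phi)).

Definition rot_v theta : 'M[R[i]]_(Nv s) :=
  diag_mx (\row_n expi (2 * pi * n%:R * (lv s * (fd s - fu s) / cel s)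
                        * cos theta)).

Definition rot theta phi : 'M[R[i]]_Nt := rot_h theta phi *t rot_v theta.

Definition steer_d theta phi : 'cV[R[i]]_Nt := rot theta phi *m steer_u theta phi.

Definition delay_vec tau : 'cV[R[i]]_(Nf s) :=
  expi (- (2 * pi * fu s * fdelta s * tau))
    *: \col_n expi (- (2 * pi * tau * n%:R * fdelta s)).

Definition structure_u (p : path_param R) : 'cV[R[i]]_Ndim :=
  kron_cV (delay_vec (delay p)) (steer_u (zenith p) (azimuth p)).

Definition structure_d (p : path_param R) : 'cV[R[i]]_Ndim :=
  kron_cV (delay_vec (delay p)) (steer_d (zenith p) (azimuth p)).

Definition channel_u NP (ch : 'I_NP -> path_param R) t : 'cV[R[i]]_Ndim :=
  \sum_(p < NP)
    (beta_u (ch p) * expi (- (2 * pi * fu s * delay (ch p)))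
       * expi (doppler_u (ch p) * t)) *: structure_u (ch p).

Definition channel_d NP (ch : 'I_NP -> path_param R) t : 'cV[R[i]]_Ndim :=
  \sum_(p < NP)
    (beta_d (ch p) * expi (- (2 * pi * fd s * delay (ch p)))
       * expi (doppler_d (ch p) * t)) *: structure_d (ch p).

(* The ratio law w^u / w^d = f^u / f^d, written so that a static path, whose
   two Doppler shifts vanish, is allowed. *)
Definition doppler_reciprocity NP (ch : 'I_NP -> path_param R) : Prop :=
  forall p, doppler_u (ch p) * fd s = doppler_d (ch p) * fu s.

Definition Qmx : 'M[R[i]]_Ndim :=
  (dftmx R (Nf s))^t* *t (dftmx R (Nh s) *t dftmx R (Nv s)).

Section Uplink.
(* [hu] is the uplink channel as a function of time; [ts 1], ..., [ts NL] are
   the sampling times. *)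
Variables (hu : R -> 'cV[R[i]]_Ndim) (ts : nat -> R) (NL : nat).

Definition ghat (i : 'I_Ndim) t : R[i] := ((col i Qmx)^t* *m hu t) 0 0.

Definition captures (eta : R) (S : {set 'I_Ndim}) : Prop :=
  eta * \sum_(1 <= l < NL.+1) sqnorm (Qmx^t* *m hu (ts l)) <=
  \sum_(1 <= l < NL.+1) \sum_(i in S) complex.Re `|ghat i (ts l)| ^+ 2.

Definition smallest_capturing (eta : R) (S : {set 'I_Ndim}) : Prop :=
  captures eta S /\ forall S', captures eta S' -> (#|S| <= #|S'|)%N.

(* With rows and columns numbered from 0, the difference a - b is the same as
   with numbering from 1.  When 0 < L <= NL - L, all the times used are among
   [ts 1], ..., [ts NL], and the natural subtractions are exact. *)
Definition pencil1 (L : nat) (i : 'I_Ndim) : 'M[R[i]]_(NL - L, L) :=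
  \matrix_(a, b) ghat i (ts (L.+1 + a - b)).

Definition pencil0 (L : nat) (i : 'I_Ndim) : 'M[R[i]]_(NL - L, L) :=
  \matrix_(a, b) ghat i (ts (L + a - b)).

(* [z] lists M nonzero eigenvalues of the L x L matrix P0^+ P1, counted with
   algebraic multiplicity.  (This matrix has rank at most the number of modes,
   so its other eigenvalues are in general the spurious zeros.) *)
Definition pencil_poles (L M : nat) (i : 'I_Ndim) (z : 'I_M -> R[i]) : Prop :=
  (forall m, z m != 0) /\
  (\prod_(m < M) ('X - (z m)%:P)
     %| char_poly (mpinv (pencil0 L i) *m pencil1 L i))%R.

End Uplink.

(* The element of {1, ..., n} congruent to k modulo n, for k >= 1. *)
Definition residue1 (n k : nat) : nat := (k.-1 %% n).+1.

(* The column number, counted from 1, of the ordinal i is i.+1. *)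
Definition idx_a (i : 'I_Ndim) : nat := residue1 Nt i.+1.
Definition idx_v (i : 'I_Ndim) : nat := residue1 (Nv s) (idx_a i).
Definition idx_h (i : 'I_Ndim) : nat := ((idx_a i - idx_v i) %/ Nv s + 1)%N.

Definition column_angles (i : 'I_Ndim) theta phi : Prop :=
  sin theta * sin phi = (idx_h i)%:R * cel s / (lh s * fu s * (Nh s)%:R) /\
  cos theta = cel s * (idx_v i)%:R / (lv s * fu s * (Nv s)%:R).

Definition dl_angle_delay (i : 'I_Ndim) theta phi : 'cV[R[i]]_Ndim :=
  ((1%:M : 'M[R[i]]_(Nf s)) *t rot theta phi) *m col i Qmx.

(* The downlink Doppler w of an uplink pole z. *)
Definition dl_doppler (z : R[i]) : R :=
  acos (complex.Re (z / `|z|)) * fd s / fu s.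

Section Reconstruction.
Variables (Ns M : nat) (sel : 'I_Ns -> 'I_Ndim).
Variables (theta phi : 'I_Ndim -> R) (z : 'I_Ns -> 'I_M -> R[i]).

Definition Dmx : 'M[R[i]]_(Ndim, Ns) :=
  \matrix_(k, j) dl_angle_delay (sel j) (theta (sel j)) (phi (sel j)) k 0.

(* Column k = j' * M + m belongs to block j'. *)
Definition Emx t : 'M[R[i]]_(Ns, Ns * M) :=
  \matrix_(j, k)
    (let: (j', m) := mxtens_unindex k in
     if j == j' then expi (dl_doppler (z j m) * t) else 0).

Definition recon1 (hd : 'cV[R[i]]_Ndim) : 'cV[R[i]]_Ndim :=
  Dmx *m mpinv Dmx *m hd.

Definition recon2 (S : 'M[R[i]]_(Ns * M)) t (n : 'rV[R[i]]_(Ns * M)) :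
    'cV[R[i]]_Ndim :=
  Dmx *m Emx t *m (mpinv S)^T *m n^T.

End Reconstruction.
End Channel.

Section Randomness.
Context (R : realType) (d : measure_display) (T : measurableType d).
Variables (P : probability T R).

Definition measurable_wrt (G : set (set T)) (X : T -> R) : Prop :=
  forall B, measurable B -> G (X @^-1` B).

Definition cmeasurable_wrt (G : set (set T)) (X : T -> R[i]) : Prop :=
  measurable_wrt G (fun w => complex.Re (X w)) /\
  measurable_wrt G (fun w => complex.Im (X w)).

Definition channel_measurable_wrt (G : set (set T)) NP
    (ch : T -> 'I_NP -> path_param R) : Prop :=
  forall p,
    [/\ measurable_wrt G (fun w => zenith (ch w p)),
        measurable_wrt G (fun w => azimuth (ch w p)) &
        measurable_wrt G (fun w => delay (ch w p))] /\
    [/\ cmeasurable_wrt G (fun w => beta_u (ch w p)),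
        cmeasurable_wrt G (fun w => beta_d (ch w p)),
        measurable_wrt G (fun w => doppler_u (ch w p)) &
        measurable_wrt G (fun w => doppler_d (ch w p))].

(* The law N(0, v); [normal_prob] is not Gaussian at standard deviation 0. *)
Definition gaussian0 (v : R) : set R -> \bar R :=
  if v == 0 then \d_(0 : R) else normal_prob 0 (Num.sqrt v).

Definition rect_event K (n : T -> 'rV[R[i]]_K) (A B : 'I_K -> set R) : set T :=
  [set w | forall k, A k (complex.Re (n w 0 k)) /\ B k (complex.Im (n w 0 k))].

(* n ~ CN(0, v I): the 2K real and imaginary parts are independent, each with
   law N(0, v / 2), so that E |n_k|^2 = v. *)
Definition complex_normal (v : R) K (n : T -> 'rV[R[i]]_K) : Prop :=
  (forall k, cmeasurable_wrt measurable (fun w => n w 0 k)) /\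
  forall A B : 'I_K -> set R,
    (forall k, measurable (A k)) -> (forall k, measurable (B k)) ->
    P (rect_event n A B) =
    \big[mule/1%E]_(k < K) (gaussian0 (v / 2) (A k) * gaussian0 (v / 2) (B k))%E.

(* n is independent of the sigma-algebra G (the events [rect_event n A B] form
   a pi-system generating the sigma-algebra of n). *)
Definition independent_of (G : set (set T)) K (n : T -> 'rV[R[i]]_K) : Prop :=
  forall F, G F -> forall A B : 'I_K -> set R,
    (forall k, measurable (A k)) -> (forall k, measurable (B k)) ->
    P (F `&` rect_event n A B) = (P F * P (rect_event n A B))%E.

End Randomness.

(* Main.v *)
(* The residual h^d - D D^+ h^d is orthogonal to the range of D, which contains
   the noise part D E (S^+)^T n^T of the reconstruction.  By Pythagoras the
   squared error is therefore the sum of the two squared norms.  The noise part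
   is A n^T with A = D E (S^+)^T: the columns of D are unit vectors, E E^* = M I
   and S is unitary, so the squared Frobenius norm of A is always Ns M.  As n is
   independent of the channel, Tonelli's theorem lets one average over n first,
   which gives E |A n^T|^2 = sigma^2 |A|_F^2 = Ns M sigma^2, whatever the channel.
   Hence the error equals the upper bound, and the lower bound follows because
   the noise term is nonnegative (possibly infinite). *)
Require Import Defs.
From HB Require Import structures.
From mathcomp Require Import all_boot all_order all_algebra.
From mathcomp Require Import all_classical all_reals all_analysis.
From mathcomp Require Import complex mxtens spectral.
From mathcomp Require Import measurable_realfun.
From mathcomp Require Import ring lra.

Set Implicit Arguments.
Unset Strict Implicit.
Unset Printing Implicit Defensive.

Import Order.TTheory GRing.Theory Num.Theory.
Import numFieldNormedType.Exports.

Local Open Scope classical_set_scope.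
Local Open Scope ring_scope.
Local Open Scope complex_scope.
Local Open Scope sesquilinear_scope.

(** * The Moore-Penrose inverse and orthogonal residuals *)

Section AdjointMatrix.
Variable C : numClosedFieldType.

Lemma adjmxM m n p (A : 'M[C]_(m, n)) (B : 'M[C]_(n, p)) :
  (A *m B)^t* = B^t* *m A^t*.
Proof. by rewrite trmx_mul map_mxM. Qed.

Lemma mxtrace_mul_adj m n (A : 'M[C]_(m, n)) :
  \tr (A *m A^t*) = \sum_i \sum_j `|A i j| ^+ 2.
Proof.
rewrite /mxtrace; apply: eq_bigr => i _; rewrite mxE; apply: eq_bigr => j _.
by rewrite !mxE normCK.
Qed.

(** The trace of [A *m A^t*] is the sum of the squared moduli of the entries of [A]; when it
    vanishes, so does each of these nonnegative terms. *)
Lemma mul_adj_eq0 m n (A : 'M[C]_(m, n)) : A *m A^t* = 0 -> A = 0.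
Proof.
move=> A0; have /eqP : \tr (A *m A^t*) = 0 by rewrite A0 mxtrace0.
rewrite mxtrace_mul_adj psumr_eq0; last by move=> i _; rewrite sumr_ge0.
move=> /allP H; apply/matrixP => i j; rewrite mxE; apply/eqP.
have := H i (mem_index_enum i); rewrite /= psumr_eq0// => /allP/(_ j).
by rewrite mem_index_enum => /(_ isT); rewrite /= sqrf_eq0 normr_eq0.
Qed.

(** If [K] kills the Gram matrix of [A], then [K *m A] has zero Gram matrix, hence is zero, and row
    freeness of [A] gives [K = 0]. *)
Lemma gram_unitmx m n (A : 'M[C]_(m, n)) : row_free A -> A *m A^t* \in unitmx.
Proof.
move=> fA; rewrite -row_free_unit -kermx_eq0.
set K := kermx _; have K0 : K *m (A *m A^t*) = 0 by apply: mulmx_ker.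
have /mul_adj_eq0 /eqP : (K *m A) *m (K *m A)^t* = 0.
  by rewrite adjmxM mulmxA -(mulmxA K) K0 mul0mx.
by rewrite mulmx_free_eq0.
Qed.

End AdjointMatrix.

Section MoorePenrose.
Variable R : realType.

(** The candidate is a right inverse of [F] times a left inverse of [B]. Both products with [B *m F]
    therefore collapse to self-adjoint projections, which yields the four Penrose equations. *)
Lemma penrose_full_rank m r n (B : 'M[R[i]]_(m, r)) (F : 'M[R[i]]_(r, n)) :
  row_free (B^t*) -> row_free F ->
  penrose (B *m F) ((F^t* *m invmx (F *m F^t*)) *m (invmx (B^t* *m B) *m B^t*)).
Proof.
move=> /gram_unitmx; rewrite trmxCK => BB /gram_unitmx FF.
have FV : F *m (F^t* *m invmx (F *m F^t*)) = 1%:M by rewrite mulmxA mulmxV.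
have VB : (invmx (B^t* *m B) *m B^t*) *m B = 1%:M by rewrite -mulmxA mulVmx.
have inv_adj k (G : 'M[R[i]]_k) : G^t* = G -> (invmx G)^t* = invmx G.
  by move=> G_adj; rewrite trmx_inv map_invmx G_adj.
set U := _ *m invmx _ in FV *; set V := invmx _ *m _ in VB *.
have AX : B *m F *m (U *m V) = B *m V by rewrite -mulmxA (mulmxA F) FV mul1mx.
have XA : (U *m V) *m (B *m F) = U *m F.
  by rewrite -mulmxA (mulmxA V) VB mul1mx.
split.
- by rewrite AX -mulmxA (mulmxA V) VB mul1mx.
- by rewrite XA -mulmxA (mulmxA F) FV mul1mx.
- by rewrite AX !adjmxM trmxCK inv_adj ?mulmxA// adjmxM trmxCK.
- by rewrite XA !adjmxM trmxCK inv_adj ?mulmxA// adjmxM trmxCK.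
Qed.

(** The rank factorization [col_base A *m row_base A] supplies the full-rank factors. *)
Lemma penrose_exists m n (A : 'M[R[i]]_(m, n)) : exists X, penrose A X.
Proof.
eexists; rewrite -{1}(mulmx_base A); apply: penrose_full_rank.
  by rewrite /row_free mxrank_map mxrank_tr; exact: col_base_full.
exact: row_base_free.
Qed.

Lemma mpinvP m n (A : 'M[R[i]]_(m, n)) : penrose A (mpinv A).
Proof.
rewrite /mpinv; case: xgetP => [X -> //|].
by have [X AX] := penrose_exists A => /(_ X).
Qed.

(** Invertibility of [S] lets both outer factors be cancelled in [S *m X *m S = S]. *)
Lemma mpinv_unitary n (S : 'M[R[i]]_n) : S \is unitarymx -> mpinv S = S^t*.
Proof.
move=> Su; have [SXS _ _ _] := mpinvP S; rewrite -invmx_unitary//.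
have Sunit := unitarymx_unit Su.
apply: (can_inj (mulKmx Sunit)); rewrite mulmxV//.
by apply: (can_inj (mulmxK Sunit)); rewrite SXS mul1mx.
Qed.

End MoorePenrose.

(** * Squared norms and Pythagoras' identity *)

Section SquaredNorm.
Variable R : realType.
Implicit Types x y : R[i].

(** A real polynomial in the two parts of [x], so that measurability follows without handling the
    complex modulus. *)
Definition sqmod x : R := complex.Re x ^+ 2 + complex.Im x ^+ 2.

Lemma sqmodE x : (sqmod x)%:C = `|x| ^+ 2.
Proof. by rewrite -add_Re2_Im2. Qed.

Lemma Re_norm_sqr x : complex.Re `|x| ^+ 2 = sqmod x.
Proof. by rewrite normc_def /= sqr_sqrtr// addr_ge0// sqr_ge0. Qed.

Lemma sqmod_ge0 x : 0 <= sqmod x.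
Proof. by rewrite addr_ge0// sqr_ge0. Qed.

Lemma sqmodM x y : sqmod (x * y) = sqmod x * sqmod y.
Proof. by apply: complexI; rewrite rmorphM /= !sqmodE normrM exprMn. Qed.

Lemma sqmod_conj x : sqmod (Num.conj x) = sqmod x.
Proof. by apply: complexI; rewrite !sqmodE norm_conjC. Qed.

Lemma sqmod_expi (a : R) : sqmod (expi a) = 1.
Proof. by rewrite /sqmod /= cos2Dsin2. Qed.

Lemma sqnormE n (v : 'cV[R[i]]_n) : sqnorm v = \sum_k sqmod (v k 0).
Proof. by apply: eq_bigr => k _; rewrite Re_norm_sqr. Qed.

Lemma sqnorm_ge0 n (v : 'cV[R[i]]_n) : 0 <= sqnorm v.
Proof. by rewrite sqnormE sumr_ge0// => k _; rewrite sqmod_ge0. Qed.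

Lemma sqnorm_inner n (v : 'cV[R[i]]_n) : (sqnorm v)%:C = (v^t* *m v) 0 0.
Proof.
rewrite sqnormE rmorph_sum mxE; apply: eq_bigr => k _ /=.
by rewrite sqmodE !mxE normCKC.
Qed.

(** The square of the Frobenius norm. *)
Definition frob m n (A : 'M[R[i]]_(m, n)) : R := \sum_i \sum_j sqmod (A i j).

Lemma frob_trace m n (A : 'M[R[i]]_(m, n)) : (frob A)%:C = \tr (A *m A^t*).
Proof.
rewrite mxtrace_mul_adj /frob rmorph_sum; apply: eq_bigr => i _ /=.
by rewrite rmorph_sum; apply: eq_bigr => j _ /=; rewrite sqmodE.
Qed.

(** In the expanded inner product both cross terms vanish, the second being the adjoint of the
    first. *)
Lemma sqnorm_orthogonalB n (u v : 'cV[R[i]]_n) :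
  v^t* *m u = 0 -> sqnorm (u - v) = sqnorm u + sqnorm v.
Proof.
move=> vu; have uv : u^t* *m v = 0.
  by rewrite -[LHS]trmxCK adjmxM trmxCK vu trmx0 map_mx0.
apply: complexI; rewrite rmorphD /= !sqnorm_inner.
rewrite [(u - v)^T]linearB map_mxB mulmxBl !mulmxBr vu uv !(subr0, sub0r) opprK.
by rewrite mxE.
Qed.

End SquaredNorm.

Section Projection.
Variable R : realType.
Variables (m n : nat) (D : 'M[R[i]]_(m, n)).

(** The matrix [D *m mpinv D] is self-adjoint and fixes [D], so taking adjoints in
    [D *m mpinv D *m D = D] shows that [D^t*] kills the residual. *)
Lemma residual_orthogonal (h : 'cV[R[i]]_m) (y : 'cV[R[i]]_n) :
  (D *m y)^t* *m (h - D *m mpinv D *m h) = 0.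
Proof.
have [DXD _ DX_adj _] := mpinvP D.
suff DP : D^t* *m (D *m mpinv D) = D^t*.
  by rewrite mulmxBr adjmxM -!mulmxA (mulmxA D) (mulmxA (D^t*)) DP subrr.
by rewrite -DX_adj -adjmxM DXD.
Qed.

End Projection.

(** * The Frobenius norm of the noise gain *)

Section FrobeniusNorm.
Variable R : realType.

Lemma sqmod0_eq0 (x : R[i]) : sqmod x = 0 -> x = 0.
Proof.
move=> x0; apply/eqP; rewrite -normr_eq0 -sqrf_eq0 -sqmodE x0.
by rewrite eqxx.
Qed.

(* The entries have squared moduli those of the identity: such a matrix is
   diagonal with unimodular diagonal entries. *)
Definition unimodular_diag n (T : 'M[R[i]]_n) :=
  forall k l, sqmod (T k l) = (k == l)%:R.

Lemma unimodular_diag1 n : unimodular_diag (1%:M : 'M[R[i]]_n).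
Proof.
move=> k l; rewrite mxE /sqmod.
by case: (k == l); rewrite /= !(expr0n, expr1n, addr0).
Qed.

Lemma unimodular_diag_expi n (f : 'I_n -> R) :
  unimodular_diag (diag_mx (\row_k expi (f k))).
Proof.
move=> k l; rewrite !mxE; case: eqP => _; rewrite ?mulr1n ?sqmod_expi//.
by rewrite mulr0n /sqmod /= !expr0n addr0.
Qed.

Lemma unimodular_diag_tens m n (T : 'M[R[i]]_m) (U : 'M[R[i]]_n) :
  unimodular_diag T -> unimodular_diag U -> unimodular_diag (T *t U).
Proof.
move=> T1 U1 k l.
case: (mxtens_indexP k) => k1 k2; case: (mxtens_indexP l) => l1 l2.
rewrite tensmxE sqmodM T1 U1 -natrM mulnb (inj_eq (can_inj (@mxtens_indexK _ _))).
by rewrite xpair_eqE.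
Qed.

(** Off-diagonal entries of [T] vanish, so [T] only multiplies each entry of [v] by a phase. *)
Lemma sqnorm_unimodular_diag n (T : 'M[R[i]]_n) (v : 'cV[R[i]]_n) :
  unimodular_diag T -> sqnorm (T *m v) = sqnorm v.
Proof.
move=> T1; rewrite !sqnormE; apply: eq_bigr => k _.
rewrite mxE (bigD1 k)//= big1 ?addr0 ?sqmodM ?T1 ?eqxx ?mul1r// => l /negPf lk.
by rewrite (@sqmod0_eq0 (T k l)) ?mul0r// T1 eq_sym lk.
Qed.

Lemma sqmod_tens m n p q (A : 'M[R[i]]_(m, n)) (B : 'M[R[i]]_(p, q)) a b :
  (forall i j, sqmod (A i j) = a) -> (forall i j, sqmod (B i j) = b) ->
  forall i j, sqmod ((A *t B) i j) = a * b.
Proof.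
move=> Aa Bb k l.
case: (mxtens_indexP k) => k1 k2; case: (mxtens_indexP l) => l1 l2.
by rewrite tensmxE sqmodM Aa Bb.
Qed.

Lemma sqmod_dftmx (X : nat) (a b : 'I_X) : sqmod (dftmx R X a b) = X%:R^-1.
Proof.
rewrite mxE sqmodM sqmod_expi mulr1 /sqmod /= expr0n addr0.
by rewrite exprVn sqr_sqrtr.
Qed.

Lemma frob_mul_unitary m n p (A : 'M[R[i]]_(m, n)) (W : 'M[R[i]]_(n, p)) :
  W \is unitarymx -> frob (A *m W) = frob A.
Proof.
move=> Wu; apply: complexI.
by rewrite !frob_trace adjmxM mulmxA mulmxtVK.
Qed.

Lemma frob_sqnorm_col m n (A : 'M[R[i]]_(m, n)) :
  frob A = \sum_j sqnorm (col j A).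
Proof.
rewrite /frob exchange_big; apply: eq_bigr => j _ /=.
by rewrite sqnormE; apply: eq_bigr => i _; rewrite mxE.
Qed.

Lemma big_mxtens_index (V : nmodType) m n (F : 'I_(m * n) -> V) :
  \sum_k F k = \sum_(i < m) \sum_(j < n) F (mxtens_index (i, j)).
Proof.
rewrite pair_bigA /= (reindex (@mxtens_index m n)) /=.
  by apply: eq_bigr => -[].
by exists (@mxtens_unindex m n) => x _; rewrite (mxtens_indexK, mxtens_unindexK).
Qed.

End FrobeniusNorm.

(** * The factors [D], [E] and the pilot matrix *)

Section NoiseGain.
Variables (R : realType) (s : ofdm_system R).

(** Each of the [Nf * Nh * Nv] entries of a column has squared modulus the inverse of that number,
    since DFT matrices have entries of constant modulus. *)
Lemma sqnorm_col_Qmx i : sqnorm (col i (Qmx s)) = 1.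
Proof.
rewrite sqnormE.
transitivity (\sum_(k < Ndim s)
    ((Nf s)%:R^-1 * ((Nh s)%:R^-1 * (Nv s)%:R^-1)) : R).
  apply: eq_bigr => k _; rewrite mxE /Qmx; apply: sqmod_tens => [a b|].
    by rewrite !mxE sqmod_conj; have := sqmod_dftmx R b a; rewrite mxE.
  by apply: sqmod_tens => a b; rewrite sqmod_dftmx.
rewrite sumr_const card_ord -[LHS]mulr_natl /Ndim /Nt !natrM -!invfM divff//.
by rewrite !mulf_neq0// pnatr_eq0 -lt0n ?Nf_gt0 ?Nh_gt0 ?Nv_gt0.
Qed.

Lemma sqnorm_dl_angle_delay i theta phi :
  sqnorm (@dl_angle_delay R s i theta phi) = 1.
Proof.
rewrite sqnorm_unimodular_diag ?sqnorm_col_Qmx//.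
apply: unimodular_diag_tens; first exact: unimodular_diag1.
by apply: unimodular_diag_tens; apply: unimodular_diag_expi.
Qed.

Variables (Ns M : nat) (sel : 'I_Ns -> 'I_(Ndim s)).
Variables (theta phi : 'I_(Ndim s) -> R) (z : 'I_Ns -> 'I_M -> R[i]).

Lemma frob_Dmx : frob (Dmx sel theta phi) = Ns%:R.
Proof.
rewrite frob_sqnorm_col (eq_bigr (fun=> 1)) ?sumr_const ?card_ord// => j _.
rewrite -(sqnorm_dl_angle_delay (sel j) (theta (sel j)) (phi (sel j))).
by congr sqnorm; apply/matrixP => k l; rewrite ord1 [LHS]mxE [LHS]mxE.
Qed.

(** Distinct rows of [E] are supported on disjoint column blocks, and each row has [M] unimodular
    entries in its own block. *)
Lemma Emx_gram t : Emx s z t *m (Emx s z t)^t* = M%:R%:M.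
Proof.
apply/matrixP => j l; rewrite !mxE big_mxtens_index.
rewrite (bigD1 j)//= [X in _ + X]big1 ?addr0; last first.
  move=> j' j'j; apply: big1 => m _; rewrite !mxE mxtens_indexK.
  by rewrite eq_sym (negPf j'j) mul0r.
have [<-|jl] := eqVneq j l; last first.
  apply: big1 => m _; rewrite !mxE mxtens_indexK eqxx [l == j]eq_sym (negPf jl).
  by rewrite conjC0 mulr0.
rewrite mulr1n (eq_bigr (fun=> 1)) ?sumr_const ?card_ord// => m _.
by rewrite !mxE mxtens_indexK eqxx -normCK -sqmodE sqmod_expi.
Qed.

Definition noise_gain (S : 'M[R[i]]_(Ns * M)) t : 'M[R[i]]_(Ndim s, Ns * M) :=
  Dmx sel theta phi *m Emx s z t *m (mpinv S)^T.

Lemma recon2E S t n :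
  recon2 sel theta phi z S t n = noise_gain S t *m n^T.
Proof. by []. Qed.

(** The unitary factor [(mpinv S)^T] does not change the Frobenius norm. The Gram matrix of [E] then
    contributes the scalar [M], and the unit columns of [D] contribute [Ns]. *)
Lemma frob_noise_gain S t :
  S \is unitarymx -> frob (noise_gain S t) = (Ns * M)%:R.
Proof.
move=> Su; rewrite frob_mul_unitary; last first.
  by rewrite mpinv_unitary// trmx_unitary trmxC_unitary.
apply: complexI; rewrite frob_trace adjmxM mulmxA -(mulmxA (Dmx _ _ _)) Emx_gram.
rewrite mul_mx_scalar -scalemxAl mxtraceZ -frob_trace frob_Dmx.
by rewrite natrM mulrC !rmorphM /= !rmorph_nat.
Qed.

End NoiseGain.

(** * Measurability *)

Section MeasurableReal.
Variable R : realType.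

(** Inversion is continuous on the open set of nonzero reals, and the remaining point 0 is a
    measurable singleton. *)
Lemma measurable_inv : measurable_fun [set: R] (@GRing.inv R).
Proof.
have -> : [set: R] = [set x | x != 0] `|` [set 0].
  apply/seteqP; split => x // _; case: (eqVneq x 0) => [->|]; by [right|left].
have mN0 : open [set x : R | x != 0] by exact: open_neq.
apply/measurable_funU; [exact: open_measurable|exact: measurable_set1|split].
  by apply: open_continuous_measurable_fun => // x; rewrite inE; exact: inv_continuous.
exact: measurable_fun_set1.
Qed.

Lemma measurable_sqrt : measurable_fun [set: R] (@Num.sqrt R).
Proof. by apply: continuous_measurable_fun; exact: sqrt_continuous. Qed.

Lemma measurable_cos : measurable_fun [set: R] (@cos R).
Proof. by apply: continuous_measurable_fun; exact: continuous_cos. Qed.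

Lemma measurable_sin : measurable_fun [set: R] (@sin R).
Proof. by apply: continuous_measurable_fun; exact: continuous_sin. Qed.

(* [acos] is constant outside [-1, 1], where its defining set is empty. *)
Lemma measurable_acos : measurable_fun [set: R] (@acos R).
Proof.
have -> : [set: R] = `]-1, 1[ `|` ([set -1] `|` ([set 1] `|` ~` `[-1, 1])).
  apply/seteqP; split => x // _; rewrite /= !in_itv /=.
  case: (ltrgtP x 1) => [x1|x1|->]; last by right; right; left.
    case: (ltrgtP x (-1)) => [xN1|xN1|->]; [|by left|by right; left].
    by right; right; right.
  by right; right; right; rewrite andbF.
apply/measurable_funU => //.
  by apply: measurableU => //; apply: measurableU => //; apply: measurableC.
split.
  apply: open_continuous_measurable_fun; first exact: interval_open.
  by move=> x; rewrite inE /= in_itv; exact: continuous_acos.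
apply/measurable_funU => //; first by apply: measurableU => //; apply: measurableC.
split; first exact: measurable_fun_set1.
apply/measurable_funU => //; first exact: measurableC.
split; first exact: measurable_fun_set1.
apply: (eq_measurable_fun (cst (get set0))); last exact: measurable_cst.
move=> x; rewrite inE /= in_itv /= => xN; rewrite unlock /=; congr get.
apply/esym; rewrite -subset0 => y [_ yx]; apply: xN.
by rewrite -yx cos_geN1 cos_le1.
Qed.

End MeasurableReal.

Section MeasurableComplex.
Context (R : realType) d (U : measurableType d).
Implicit Types X Y : U -> R[i].

(** The domain [U] is left arbitrary because the sample space is later equipped with several
    sigma-algebras in turn. *)
Definition cmeasurable X : Prop :=
  measurable_fun setT (fun w => complex.Re (X w)) /\
  measurable_fun setT (fun w => complex.Im (X w)).

Lemma cmeasurable_cst c : cmeasurable (fun=> c).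
Proof. by split; exact: measurable_cst. Qed.

Lemma cmeasurableD X Y :
  cmeasurable X -> cmeasurable Y -> cmeasurable (fun w => X w + Y w).
Proof.
move=> [rX iX] [rY iY]; split.
  rewrite (_ : (fun _ => _) = (fun w => complex.Re (X w) + complex.Re (Y w))).
    exact: measurable_funD.
  by apply/funext => w; case: (X w) (Y w) => ? ? [].
rewrite (_ : (fun _ => _) = (fun w => complex.Im (X w) + complex.Im (Y w))).
  exact: measurable_funD.
by apply/funext => w; case: (X w) (Y w) => ? ? [].
Qed.

Lemma cmeasurableM X Y :
  cmeasurable X -> cmeasurable Y -> cmeasurable (fun w => X w * Y w).
Proof.
move=> [rX iX] [rY iY]; split.
  rewrite (_ : (fun _ => _) = (fun w => complex.Re (X w) * complex.Re (Y w)
      - complex.Im (X w) * complex.Im (Y w))).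
    by apply: measurable_funB; exact: measurable_funM.
  by apply/funext => w; case: (X w) (Y w) => ? ? [].
rewrite (_ : (fun _ => _) = (fun w => complex.Re (X w) * complex.Im (Y w)
    + complex.Im (X w) * complex.Re (Y w))).
  by apply: measurable_funD; exact: measurable_funM.
by apply/funext => w; case: (X w) (Y w) => ? ? [].
Qed.

Lemma cmeasurableN X : cmeasurable X -> cmeasurable (fun w => - X w).
Proof.
move=> mX; rewrite (_ : (fun _ => _) = (fun w => (-1) * X w)).
  by apply: cmeasurableM => //; exact: cmeasurable_cst.
by apply/funext => w; rewrite mulN1r.
Qed.

Lemma cmeasurable_sum (I : Type) (r : seq I) (X : I -> U -> R[i]) :
  (forall i, cmeasurable (X i)) -> cmeasurable (fun w => \sum_(i <- r) X i w).
Proof.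
move=> mX; elim: r => [|i r IHr].
  under [X in cmeasurable X]funext do rewrite big_nil; exact: cmeasurable_cst.
by under [X in cmeasurable X]funext do rewrite big_cons; exact: cmeasurableD.
Qed.

Lemma cmeasurable_expi (f : U -> R) :
  measurable_fun setT f -> cmeasurable (fun w => expi (f w)).
Proof.
move=> mf; split; [exact: (measurableT_comp (@measurable_cos R))
                  |exact: (measurableT_comp (@measurable_sin R))].
Qed.

Lemma measurable_sqmod X :
  cmeasurable X -> measurable_fun setT (fun w => sqmod (X w)).
Proof. by move=> [rX iX]; apply: measurable_funD; exact: measurable_funX. Qed.

Lemma measurable_sqnorm n (v : U -> 'cV[R[i]]_n) :
  (forall k, cmeasurable (fun w => v w k 0)) ->
  measurable_fun setT (fun w => sqnorm (v w)).
Proof.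
move=> mv; under eq_fun do rewrite sqnormE.
by apply: measurable_sum => k; exact: measurable_sqmod.
Qed.

Lemma cmeasurable_mulmx m n p (A : U -> 'M[R[i]]_(m, n))
    (B : U -> 'M[R[i]]_(n, p)) :
  (forall i j, cmeasurable (fun w => A w i j)) ->
  (forall i j, cmeasurable (fun w => B w i j)) ->
  forall i j, cmeasurable (fun w => (A w *m B w) i j).
Proof.
move=> mA mB i j; under [X in cmeasurable X]funext do rewrite mxE.
by apply: cmeasurable_sum => k; exact: cmeasurableM.
Qed.

Lemma cmeasurable_mul_tens m n p q (A : U -> 'M[R[i]]_(m, n))
    (B : U -> 'M[R[i]]_(p, q)) :
  (forall i j, cmeasurable (fun w => A w i j)) ->
  (forall i j, cmeasurable (fun w => B w i j)) ->
  forall i j, cmeasurable (fun w => (A w *t B w) i j).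
Proof.
move=> mA mB i j; under [X in cmeasurable X]funext do rewrite mxE.
exact: cmeasurableM.
Qed.

(** The composite is a finite combination of indicators of the level sets of [c]. This is how
    expressions in the selected columns, the pseudo-inverse of [D] included, become measurable. *)
Lemma cmeasurable_finite (J : finType) (c : U -> J) (f : J -> R[i]) :
  (forall j, measurable (c @^-1` [set j])) -> cmeasurable (fun w => f (c w)).
Proof.
move=> mc; suff mfin (g : J -> R) : measurable_fun setT (g \o c).
  split; first exact (mfin (fun j => complex.Re (f j))).
  exact (mfin (fun j => complex.Im (f j))).
rewrite (_ : g \o c = fun w => \sum_j g j * \1_(c @^-1` [set j]) w).
  apply: measurable_sum => j; apply: measurable_funM => //.
apply/funext => w /=; rewrite (bigD1 (c w))//= indicE mem_set// mulr1.
rewrite big1 ?addr0// => j jc; rewrite indicE memNset ?mulr0// => /= cj.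
by rewrite cj eqxx in jc.
Qed.

Lemma cmeasurable_comp d' (V : measurableType d') (X : V -> R[i]) (f : U -> V) :
  @measurable_fun _ _ V R setT (fun v => complex.Re (X v)) /\
  @measurable_fun _ _ V R setT (fun v => complex.Im (X v)) ->
  measurable_fun setT f -> cmeasurable (fun w => X (f w)).
Proof.
by move=> [rX iX] mf; split; [exact: (measurableT_comp rX)|exact: (measurableT_comp iX)].
Qed.

End MeasurableComplex.

(** * Measurability of the channel and of its reconstruction *)

Section MeasurableReconstruction.
Context (R : realType) d (U : measurableType d) (s : ofdm_system R).

Lemma cmeasurable_channel_d NP (ch : U -> 'I_NP -> path_param R) t :
  (forall p,
    [/\ measurable_fun setT (fun w => zenith (ch w p)),
        measurable_fun setT (fun w => azimuth (ch w p)),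
        measurable_fun setT (fun w => delay (ch w p)),
        cmeasurable (fun w => beta_d (ch w p)) &
        measurable_fun setT (fun w => doppler_d (ch w p))]) ->
  forall k, cmeasurable (fun w => channel_d s (ch w) t k 0).
Proof.
move=> mch k; under [X in cmeasurable X]funext do rewrite summxE.
apply: cmeasurable_sum => p; have [mz ma md mb mw] := mch p.
have mcz := measurableT_comp (@measurable_cos R) mz.
have mca := measurableT_comp (@measurable_cos R) ma.
under [X in cmeasurable X]funext do rewrite mxE.
apply: cmeasurableM.
  apply: cmeasurableM; last by apply: cmeasurable_expi; exact: measurable_funM.
  apply: cmeasurableM => //; apply: cmeasurable_expi.
  by apply: measurable_funN; exact: measurable_funM.
have mdiag n (f : U -> 'rV[R[i]]_n) i j : (forall j, cmeasurable (fun w => f w 0 j)) ->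
    cmeasurable (fun w => diag_mx (f w) i j).
  move=> mf; under [X in cmeasurable X]funext do rewrite mxE.
  case: eqP => _; first by under [X in cmeasurable X]funext do rewrite mulr1n.
  by under [X in cmeasurable X]funext do rewrite mulr0n; exact: cmeasurable_cst.
apply: cmeasurable_mul_tens => {k} [i j|i j].
  under [X in cmeasurable X]funext do rewrite !mxE.
  apply: cmeasurableM; apply: cmeasurable_expi; apply: measurable_funN.
    exact: measurable_funM.
  by do !apply: measurable_funM => //.
apply: cmeasurable_mulmx => {i j} i j.
  apply: cmeasurable_mul_tens => {i j} i j; apply: mdiag => {i j} j.
    under [X in cmeasurable X]funext do rewrite mxE.
    by apply: cmeasurable_expi; do !apply: measurable_funM => //.
  under [X in cmeasurable X]funext do rewrite mxE.
  by apply: cmeasurable_expi; do !apply: measurable_funM => //.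
apply: cmeasurable_mul_tens => {i j} i j.
  under [X in cmeasurable X]funext do rewrite mxE.
  by apply: cmeasurable_expi; do !apply: measurable_funM => //.
under [X in cmeasurable X]funext do rewrite mxE.
by apply: cmeasurable_expi; do !apply: measurable_funM => //.
Qed.

(** Division by the real number [|z|] scales the real part, which turns the argument of [acos] into
    a product of measurable real functions. *)
Lemma measurable_dl_doppler (z : U -> R[i]) :
  cmeasurable z -> measurable_fun setT (fun w => dl_doppler s (z w)).
Proof.
move=> mz; have mN := measurableT_comp (@measurable_inv R)
  (measurableT_comp (@measurable_sqrt R) (measurable_sqmod mz)).
rewrite (_ : (fun _ => _) = fun w =>
    acos (complex.Re (z w) * (Num.sqrt (sqmod (z w)))^-1) * fd s / fu s).
  apply: measurable_funM => //; apply: measurable_funM => //.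
  apply: (measurableT_comp (@measurable_acos R)); apply: measurable_funM => //.
  by case: mz.
apply/funext => w; rewrite /dl_doppler normc_def -/(sqmod _).
rewrite -[_^-1]fmorphV; congr (acos _ * _ / _).
by case: (z w) => a b /=; rewrite mulr0 subr0.
Qed.

Variables (Ns M : nat) (sel : U -> 'I_Ns -> 'I_(Ndim s)).
Variables (theta phi : 'I_(Ndim s) -> R) (z : U -> 'I_Ns -> 'I_M -> R[i]).
Hypothesis sel_meas : forall j i, measurable [set w | sel w j = i].
Hypothesis z_meas : forall j m, cmeasurable (fun w => z w j m).

(** The finite functions form a [finType], as [cmeasurable_finite] requires of the values of the
    selection. *)
Let selF w : {ffun 'I_Ns -> 'I_(Ndim s)} := [ffun j => sel w j].

Let selF_meas f : measurable (selF @^-1` [set f]).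
Proof.
rewrite (_ : _ @^-1` _ = \bigcap_(j in [set: 'I_Ns]) [set w | sel w j = f j]).
  apply: fin_bigcap_measurable => // j _; exact: sel_meas.
apply/seteqP; split => [w /= <- j _|w fw] /=; first by rewrite ffunE.
by apply/ffunP => j; rewrite ffunE; exact: fw.
Qed.

Let selE w : sel w = selF w.
Proof. by apply/funext => j; rewrite ffunE. Qed.

Lemma cmeasurable_recon1 (hd : U -> 'cV[R[i]]_(Ndim s)) :
  (forall k, cmeasurable (fun w => hd w k 0)) ->
  forall k, cmeasurable (fun w => recon1 (sel w) theta phi (hd w) k 0).
Proof.
move=> mh k; apply: cmeasurable_mulmx => [i j|i j]; last first.
  by rewrite ord1.
under [X in cmeasurable X]funext do rewrite selE.
pose f (c : {ffun 'I_Ns -> 'I_(Ndim s)}) :=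
  (Dmx c theta phi *m mpinv (Dmx c theta phi)) i j.
exact: (@cmeasurable_finite _ _ _ _ selF f).
Qed.

Lemma cmeasurable_noise_gain S t i j :
  cmeasurable (fun w => noise_gain (sel w) theta phi (z w) S t i j).
Proof.
apply: cmeasurable_mulmx => {i j} i j; last exact: cmeasurable_cst.
apply: cmeasurable_mulmx => {i j} i j.
  under [X in cmeasurable X]funext do rewrite selE.
  pose f (c : {ffun 'I_Ns -> 'I_(Ndim s)}) := Dmx c theta phi i j.
  exact: (@cmeasurable_finite _ _ _ _ selF f).
under [X in cmeasurable X]funext do rewrite mxE.
case: (mxtens_unindex j) => j' m; case: eqP => _; last exact: cmeasurable_cst.
apply: cmeasurable_expi; apply: measurable_funM => //.
exact: measurable_dl_doppler.
Qed.

End MeasurableReconstruction.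

(** * Moments of Gaussian variables *)

Section NormalMoments.
Variables (R : realType) (s : R).
Hypothesis s0 : s != 0.
Local Notation mu := (@lebesgue_measure R).
Local Notation pdf := (normal_pdf 0 s).

Lemma normal_pdf0E x : pdf x = normal_peak s * expR (- x ^+ 2 / (s ^+ 2 *+ 2)).
Proof. by rewrite normal_pdfE// /normal_fun subr0. Qed.

Lemma normal_pdf0N x : pdf (- x) = pdf x.
Proof. by rewrite !normal_pdf0E sqrrN. Qed.

(** The centred density satisfies [pdf' = - x / s ^+ 2 * pdf]; its multiple by [- s ^+ 2] is the
    antiderivative for the integration by parts below. *)
Lemma is_derive_normal_pdf0 (x : R) :
  is_derive x 1 (fun y => - s ^+ 2 * pdf y) (x * pdf x).
Proof.
have -> : (fun y => - s ^+ 2 * pdf y) =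
    (fun y => (- s ^+ 2 * normal_peak s) *: expR ((- (s ^+ 2 *+ 2)^-1) *: (y ^+ 2))).
  apply/funext => y; rewrite normal_pdf0E /GRing.scale /= mulrA; congr (_ * expR _).
  by rewrite mulNr mulNr mulrC.
rewrite normal_pdf0E; apply: is_derive_eq.
rewrite /GRing.scale /= !mulr1 -mulrA.
rewrite (_ : - (s ^+ 2 *+ 2)^-1 * x ^+ 2 = - x ^+ 2 / (s ^+ 2 *+ 2)); last first.
  by rewrite !mulNr mulrC.
by field.
Qed.

(** Bounded intervals exhausting the line; [n.+1] keeps them nondegenerate at [n = 0]. *)
Local Notation itvN n := (`[- n.+1%:R, n.+1%:R]%classic : set R).

Let nd_itvN : nondecreasing_seq (fun n => itvN n).
Proof.
move=> m n mn; rewrite subsetEset => x; rewrite /= !in_itv /= => /andP[mx xm].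
have mn' : m.+1%:R <= n.+1%:R :> R by rewrite ler_nat.
by rewrite (le_trans _ mx) ?lerN2// (le_trans xm).
Qed.

Let bigcup_itvN : \bigcup_n itvN n = setT.
Proof.
apply/seteqP; split => // x _; exists (Num.truncn `|x|) => //.
by rewrite /= in_itv /= -ler_norml ltW// truncnS_gt.
Qed.

(** Integration by parts with [x] as one factor and [x * pdf x] as the derivative of the other. As
    the density is even, the two endpoints contribute equally to the boundary term. *)
Lemma normal_moment2_itv (n : nat) :
  (\int[mu]_(x in itvN n) (x ^+ 2 * pdf x)%:E =
   (- (2 * n.+1%:R * s ^+ 2 * pdf n.+1%:R))%:E
     + (s ^+ 2)%:E * \int[mu]_(x in itvN n) (pdf x)%:E)%E.
Proof.
have cpdf := @continuous_normal_pdf R 0 s s0.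
under eq_integral do rewrite expr2 -mulrA.
rewrite (@integration_by_parts _ id (fun y => - s ^+ 2 * pdf y) (fun=> 1)
  (fun y => y * pdf y)); last 7 first.
- by rewrite gtrN.
- by apply: continuous_subspaceT => x; exact: cst_continuous.
- split => [x _|//|//]; first exact: derivable_id.
    by apply: cvg_at_right_filter; exact: cvg_id.
  by apply: cvg_at_left_filter; exact: cvg_id.
- by move=> x _; rewrite derive1E derive_id.
- by apply: continuous_subspaceT => x; apply: cvgM => //; exact: cpdf.
- have cG x : {for x, continuous (fun y : R => - s ^+ 2 * pdf y)}.
    by apply: cvgM; [exact: cvg_cst|exact: cpdf].
  split => [x _|//|//].
  - by have [] := is_derive_normal_pdf0 x.
  - by apply: cvg_at_right_filter; exact: cG.
  - by apply: cvg_at_left_filter; exact: cG.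
- by move=> x _; rewrite derive1E; apply: derive_val; exact: is_derive_normal_pdf0.
have -> : (\int[mu]_(x in `[(- n.+1%:R)%R, n.+1%:R]) (1 * (- s ^+ 2 * pdf x))%:E
    = (- s ^+ 2)%:E * \int[mu]_(x in itvN n) (pdf x)%:E)%E.
  rewrite -integralZl//; last first.
    by apply: (integrableS measurableT) => //; exact: integrable_normal_pdf.
  by apply: eq_integral => x _; rewrite mul1r.
rewrite EFinN mulNe oppeK normal_pdf0N; congr (_%:E + _)%E.
lra.
Qed.

Let cvg_normal_tail :
  2 * n.+1%:R * s ^+ 2 * pdf n.+1%:R @[n --> \oo] --> (0 : R).
Proof.
(* With [y = n.+1%:R ^+ 2 / (s ^+ 2 *+ 2)], the inequality [1 + y <= expR y] gives
   [expR (- y) <= y^-1], which bounds the boundary term by a constant over [n.+1]. *)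
apply: (@squeeze_cvgr _ _ _ _ (cst 0)
  (fun n => (4 * s ^+ 4 * normal_peak s) * harmonic n)).
- apply: nearW => n /=; have c0 : 0 <= 2 * n.+1%:R * s ^+ 2.
    by apply: mulr_ge0; [exact: mulr_ge0|exact: sqr_ge0].
  rewrite mulr_ge0 ?normal_pdf_ge0//=.
  rewrite normal_pdf0E mulNr expRN.
  set y := n.+1%:R ^+ 2 / _.
  have y0 : 0 < y by rewrite divr_gt0 ?exprn_gt0// pmulrn_lgt0// exprn_even_gt0.
  have : (expR y)^-1 <= y^-1.
    by rewrite lef_pV2 ?posrE ?expR_gt0//; apply: le_trans (expR_ge1Dx y); rewrite lerDr.
  have -> : 4 * s ^+ 4 * normal_peak s / n.+1%:R =
      2 * n.+1%:R * s ^+ 2 * (normal_peak s * y^-1).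
    by rewrite /y; field; rewrite s0 /= addrC natr1 pnatr_eq0.
  by move=> ey; rewrite ler_wpM2l// ler_wpM2l ?normal_peak_ge0.
- exact: cvg_cst.
- rewrite -[X in _ --> X](mulr0 (4 * s ^+ 4 * normal_peak s)); apply: cvgMr.
  exact: cvg_harmonic.
Qed.

Let cvg_integral_itvN (f : R -> R) : measurable_fun setT f -> (forall x, 0 <= f x) ->
  (\int[mu]_(x in itvN n) (f x)%:E @[n --> \oo] --> \int[mu]_x (f x)%:E)%E.
Proof.
move=> mf f0.
have := @ge0_nondecreasing_set_cvg_integral _ (measurableTypeR R) R (fun n => itvN n)
  (fun x => (f x)%:E) mu nd_itvN.
rewrite bigcup_itvN; apply => //.
- by move=> n; apply/measurable_EFinP; exact: measurable_funTS.
- by move=> n x _; rewrite lee_fin.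
Qed.

Lemma measurable_normal_moment2 : measurable_fun setT (fun x : R => x ^+ 2 * pdf x).
Proof.
apply: measurable_funM; first exact: exprn_measurable.
exact: measurable_normal_pdf.
Qed.

(** In the limit of [normal_moment2_itv] the boundary term vanishes and the density integrates to
    1. *)
Lemma normal_moment2 : (\int[mu]_x (x ^+ 2 * pdf x)%:E = (s ^+ 2)%:E)%E.
Proof.
have := cvg_integral_itvN measurable_normal_moment2
  (fun x => mulr_ge0 (sqr_ge0 x) (normal_pdf_ge0 0 s x)).
under eq_cvg do rewrite normal_moment2_itv.
move=> /cvg_unique; apply => //.
have c1 : ((- (2 * n.+1%:R * s ^+ 2 * pdf n.+1%:R))%:E @[n --> \oo] --> 0%:E)%E.
  have := cvgN cvg_normal_tail; rewrite oppr0 => c0.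
  by apply: cvg_EFin; [exact: nearW|exact: c0].
have c2 : ((s ^+ 2)%:E * \int[mu]_(x in itvN n) (pdf x)%:E @[n --> \oo]
    --> (s ^+ 2)%:E * \int[mu]_x (pdf x)%:E)%E.
  apply: cvgeZl => //; apply: cvg_integral_itvN; first exact: measurable_normal_pdf.
  exact: normal_pdf_ge0.
have := cvgeD _ c1 c2; rewrite integral_normal_pdf mule1 add0e; exact.
Qed.

End NormalMoments.

(** * Integration against a Gaussian law *)

Section GaussianLaw.
Variable R : realType.
Local Notation mu := (@lebesgue_measure R).

(** The Radon-Nikodym derivative of the normal law and the explicit density have equal integrals
    over every measurable set, hence agree almost everywhere. *)
Lemma ge0_integral_normal_prob (s : R) (f : R -> \bar R) :
  measurable_fun setT f -> (forall x, 0 <= f x)%E ->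
  (\int[normal_prob 0 s]_x f x = \int[mu]_x (f x * (normal_pdf 0 s x)%:E))%E.
Proof.
move=> mf f0; have dom := normal_prob_dominates 0 s.
rewrite -(Radon_Nikodym_SigmaFinite.change_of_variables dom)//.
have intf := Radon_Nikodym_SigmaFinite.f_integrable dom.
have mpdf : measurable_fun setT (fun x : measurableTypeR R => (normal_pdf 0 s x)%:E).
  by apply/measurable_EFinP; exact: measurable_normal_pdf.
apply: ae_eq_integral => //.
- by apply: emeasurable_funM => //; exact: (measurable_int _ intf).
- exact: emeasurable_funM.
- apply: ae_eqe_mul2l; apply: integral_ae_eq => //= A _ mA.
  by rewrite -Radon_Nikodym_SigmaFinite.f_integral.
Qed.

Context d (T : measurableType d) (P : probability T R).
Variables (X : T -> R) (v : R).
Hypothesis mX : measurable_fun setT X.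
Hypothesis v0 : 0 <= v.
Hypothesis lawX : forall A, measurable A -> P (X @^-1` A) = gaussian0 v A.

Lemma ge0_integral_gaussian (f : R -> \bar R) :
  measurable_fun setT f -> (forall x, 0 <= f x)%E ->
  (\int[P]_w f (X w) = if (v == 0)%R then f 0%R else
     \int[mu]_x (f x * (normal_pdf 0 (Num.sqrt v) x)%:E))%E.
Proof.
move=> mf f0; pose X' : {mfun T >-> measurableTypeR R} :=
  HB.pack X (isMeasurableFun.Build _ _ _ (measurableTypeR R) X mX).
rewrite -[LHS](@ge0_integral_distribution _ _ _ _ _ P X' f mf f0).
case: eqP => [v00|/eqP/negbTE vN0]; last first.
  rewrite -ge0_integral_normal_prob//; apply: eq_measure_integral => A mA _.
  by rewrite /= /distribution /pushforward lawX// /gaussian0 vN0.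
transitivity (\int[dirac (0%R : measurableTypeR R)]_x f x)%E.
  apply: eq_measure_integral => A mA _.
  by rewrite /= /distribution /pushforward lawX// /gaussian0 v00 eqxx.
by rewrite integral_dirac// diracT mul1e.
Qed.

Lemma gaussian_moment2 : (\int[P]_w (X w ^+ 2)%:E = v%:E)%E.
Proof.
rewrite (@ge0_integral_gaussian (fun x => (x ^+ 2)%:E)); last 2 first.
- by apply/measurable_EFinP; exact: exprn_measurable.
- by move=> x; rewrite lee_fin sqr_ge0.
case: eqP => [->|/eqP vN0]; first by rewrite expr0n.
under eq_integral do rewrite -EFinM.
by rewrite normal_moment2 ?sqr_sqrtr// sqrtr_eq0 -ltNge lt0r vN0.
Qed.

Lemma integrable_gaussian_sqr : P.-integrable setT (fun w => (X w ^+ 2)%:E).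
Proof.
apply/integrableP; split; first by apply/measurable_EFinP; exact: measurable_funX.
under eq_integral do rewrite gee0_abs ?lee_fin ?sqr_ge0//.
by rewrite gaussian_moment2 ltry.
Qed.

Lemma integrable_gaussian : P.-integrable setT (fun w => (X w)%:E).
Proof.
(* Domination by the second moment: [|x| <= 1 + x ^+ 2]. *)
apply: (@le_integrable _ _ _ _ _ measurableT _ (fun w => 1 + (X w ^+ 2)%:E)%E).
- exact/measurable_EFinP.
- move=> w _; rewrite !abse_EFin lee_fin; apply: le_trans (ler_norm _).
  by rewrite -[X w ^+ 2]real_normK ?num_real//; nra.
- apply: integrableD => //; last exact: integrable_gaussian_sqr.
  exact: finite_measure_integrable_cst.
Qed.

(** By symmetry of the law the positive and negative parts have the same integral, which is finite,
    so the difference is 0. *)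
Lemma gaussian_mean : (\int[P]_w (X w)%:E = 0)%E.
Proof.
have mp : measurable_fun setT (fun x : R => (Num.max x 0)%:E).
  by apply/measurable_EFinP; exact: measurable_maxr.
have mn : measurable_fun setT (fun x : R => (Num.max (- x) 0)%:E).
  by apply/measurable_EFinP; apply: measurable_maxr => //; exact: oppr_measurable.
have p0 (x : R) : (0 <= (Num.max x 0)%:E)%E by rewrite lee_fin le_max lexx orbT.
have intX := integrable_gaussian.
have posneg : (\int[P]_w (Num.max (X w) 0)%:E = \int[P]_w (Num.max (- X w) 0)%:E)%E.
  rewrite (@ge0_integral_gaussian (fun x => (Num.max x 0)%:E))//.
  rewrite (@ge0_integral_gaussian (fun x => (Num.max (- x) 0)%:E))//.
  case: eqP => [_|/eqP vN0]; first by rewrite oppr0.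
  have s0 : Num.sqrt v != 0 by rewrite sqrtr_eq0 -ltNge lt0r vN0.
  pose g (x : measurableTypeR R) :=
    ((Num.max x 0)%:E * (normal_pdf 0 (Num.sqrt v) x)%:E)%E.
  (* Lebesgue measure is its own image under negation, and the density is even. *)
  transitivity (\int[pushforward mu (-%R : _ -> measurableTypeR R)]_x g x)%E.
    by apply: eq_measure_integral => A mA _; exact/esym/lebesgue_measureN.
  rewrite ge0_integral_pushforward//=.
  - by apply: eq_integral => x _; rewrite /g /= normal_pdf0N.
  - apply: emeasurable_funM => //; apply/measurable_EFinP.
    exact: measurable_normal_pdf.
  - by move=> x _; rewrite mule_ge0// lee_fin normal_pdf_ge0.
rewrite integralE.
rewrite [X in (_ - X)%E](_ : _ = \int[P]_w ((EFin \o X)^\+ w))%E.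
  by rewrite subee// integrable_pos_fin_num.
under eq_integral do rewrite funenegE /= -EFin_max.
by under [RHS]eq_integral do rewrite funeposE /= -EFin_max.
Qed.

End GaussianLaw.

(** * Independence *)

Section IndependentPair.
Context (R : realType) d (T : measurableType d) (P : probability T R).
Context dU (U : measurableType dU) dV (V : measurableType dV).
Variables (X : {mfun T >-> U}) (Y : {mfun T >-> V}).
Hypothesis XY : forall A B, measurable A -> measurable B ->
  P (X @^-1` A `&` Y @^-1` B) = (P (X @^-1` A) * P (Y @^-1` B))%E.

Let mpair : measurable_fun setT (fun w => (X w, Y w)).
Proof. by apply: measurable_fun_pair. Qed.

Let Z : {mfun T >-> (U * V)%type} :=
  HB.pack (fun w => (X w, Y w)) (isMeasurableFun.Build _ _ _ _ _ mpair).

(** Independence gives agreement with the product measure on rectangles, and this determines the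
    joint law. *)
Let law_pair A : measurable A ->
  distribution P Z A = (distribution P X \x distribution P Y)%E A.
Proof.
by move=> mA; apply/esym/product_measure_unique.
Qed.

Lemma tonelli_independent (h : U * V -> \bar R) :
  measurable_fun setT h -> (forall u, 0 <= h u)%E ->
  (\int[P]_w h (X w, Y w) = \int[P]_w \int[P]_w' h (X w, Y w'))%E.
Proof.
move=> mh h0.
rewrite -[LHS](@ge0_integral_distribution _ _ _ _ _ P Z h mh h0).
transitivity (\int[distribution P X \x distribution P Y]_z h z)%E.
  by apply: eq_measure_integral => A mA _; exact: law_pair.
rewrite fubini_tonelli1// ge0_integral_distribution//.
- apply: eq_integral => w _ /=; rewrite /fubini_F ge0_integral_distribution//.
  exact: measurable_fun_pair2.
- exact: measurable_fun_fubini_tonelli_F.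
- by move=> y; exact: integral_ge0.
Qed.

(** Tonelli applied to the absolute value gives integrability for the product law. Integrability of
    every section lets the inner integral be carried back to [T] at each [u]. *)
Lemma fubini_independent (h : U * V -> \bar R) :
  measurable_fun setT h -> P.-integrable setT (fun w => h (X w, Y w)) ->
  (forall u, P.-integrable setT (fun w => h (u, Y w))) ->
  (\int[P]_w h (X w, Y w) = \int[P]_w \int[P]_w' h (X w, Y w'))%E.
Proof.
move=> mh ih ihY.
have ihXY : (distribution P X \x distribution P Y)%E.-integrable setT h.
  apply/integrableP; split => //; have /integrableP[_] := ih.
  rewrite (tonelli_independent (h := abse \o h))//=; last first.
    exact: measurableT_comp.
  rewrite fubini_tonelli1//; last exact: measurableT_comp.
  rewrite ge0_integral_distribution//=; last 2 first.
  - by apply: measurable_fun_fubini_tonelli_F => //; exact: measurableT_comp.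
  - by move=> y; exact: integral_ge0.
  apply: le_lt_trans; rewrite le_eqVlt; apply/orP; left; apply/eqP.
  apply: eq_integral => w _ /=; rewrite /fubini_F ge0_integral_distribution//=.
  by apply: measurableT_comp => //; exact: measurable_fun_pair2.
rewrite -[LHS](@integral_distribution _ _ _ _ _ P Z h mh ih).
transitivity (\int[distribution P X \x distribution P Y]_z h z)%E.
  by apply: eq_measure_integral => A mA _; exact: law_pair.
rewrite -integral12_prod_meas1//.
have FE u : fubini_F (distribution P Y) h u = (\int[P]_w h (u, Y w))%E.
  by rewrite /fubini_F integral_distribution;
    [by []|exact: measurable_fun_pair2|exact: ihY].
have mF := measurable_fubini_F ihXY; have iF := integrable_fubini_F ihXY.
rewrite integral_distribution//=.
- by apply: eq_integral => w _ /=; rewrite FE.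
- apply/integrableP; split; first exact: measurableT_comp.
  rewrite -(@ge0_integral_distribution _ _ _ _ _ P X
    (abse \o fubini_F (distribution P Y) h))//.
  + by have /integrableP[] := iF.
  + exact: measurableT_comp.
  + by move=> y /=; exact: abse_ge0.
Qed.

End IndependentPair.

(** * Second moments of Gaussian linear forms *)

Section GaussianQuadratic.
Context (R : realType) d (T : measurableType d) (P : probability T R).
Variables (v : R) (v0 : 0 <= v).

Lemma integrable_gaussianM (X Y : T -> R) :
  measurable_fun setT X -> measurable_fun setT Y ->
  (forall A, measurable A -> P (X @^-1` A) = gaussian0 v A) ->
  (forall A, measurable A -> P (Y @^-1` A) = gaussian0 v A) ->
  P.-integrable setT (fun w => (X w * Y w)%:E).
Proof.
(* Domination: [|x * y| <= x ^+ 2 + y ^+ 2]. *)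
move=> mX mY lX lY; apply: (@le_integrable _ _ _ _ _ measurableT _
  (fun w => (X w ^+ 2)%:E + (Y w ^+ 2)%:E)%E).
- by apply/measurable_EFinP; exact: measurable_funM.
- move=> w _; rewrite -EFinD !abse_EFin lee_fin.
  apply: le_trans (ler_norm _); rewrite normrM -[X w ^+ 2]real_normK ?num_real//.
  by rewrite -[Y w ^+ 2]real_normK ?num_real//; nra.
- by apply: integrableD => //; [exact: (integrable_gaussian_sqr mX v0 lX)
                               |exact: (integrable_gaussian_sqr mY v0 lY)].
Qed.

(** Averaging over [Y] first leaves a multiple of its mean, which is 0. *)
Lemma gaussian_cross_moment (X Y : T -> R) :
  measurable_fun setT X -> measurable_fun setT Y ->
  (forall A, measurable A -> P (X @^-1` A) = gaussian0 v A) ->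
  (forall A, measurable A -> P (Y @^-1` A) = gaussian0 v A) ->
  (forall A B, measurable A -> measurable B ->
     P (X @^-1` A `&` Y @^-1` B) = (gaussian0 v A * gaussian0 v B)%E) ->
  (\int[P]_w (X w * Y w)%:E = 0)%E.
Proof.
move=> mX mY lX lY lXY.
pose X' : {mfun T >-> R} := HB.pack X (isMeasurableFun.Build _ _ _ _ X mX).
pose Y' : {mfun T >-> R} := HB.pack Y (isMeasurableFun.Build _ _ _ _ Y mY).
have indXY A B : measurable A -> measurable B ->
    P (X' @^-1` A `&` Y' @^-1` B) = (P (X' @^-1` A) * P (Y' @^-1` B))%E.
  by move=> mA mB; rewrite /= lX// lY// lXY.
have iY := integrable_gaussian mY v0 lY.
have mprod : measurable_fun setT (fun u : R * R => (u.1 * u.2)%:E).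
  by apply/measurable_EFinP; apply: measurable_funM.
have := @fubini_independent _ _ _ P _ _ _ _ X' Y' indXY (fun u => (u.1 * u.2)%:E) mprod.
move=> /= ->.
- rewrite -[RHS](@integral0 _ _ _ P setT); apply: eq_integral => w _.
  under eq_integral do rewrite EFinM.
  by rewrite integralZl// (gaussian_mean mY v0 lY) mule0.
- exact: integrable_gaussianM.
- move=> u; under eq_fun do rewrite EFinM.
  exact: integrableZl.
Qed.

(** Expanding the square involves the coordinates only in pairs: the diagonal terms give the
    variances, and the cross moments vanish by pairwise independence. *)
Lemma gaussian_linear_form_moment2 (I : finType) (X : I -> T -> R) (c : I -> R) :
  (forall i, measurable_fun setT (X i)) ->
  (forall i A, measurable A -> P (X i @^-1` A) = gaussian0 v A) ->
  (forall i j A B, i != j -> measurable A -> measurable B ->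
     P (X i @^-1` A `&` X j @^-1` B) = (gaussian0 v A * gaussian0 v B)%E) ->
  (\int[P]_w ((\sum_i c i * X i w) ^+ 2)%:E = (v * \sum_i c i ^+ 2)%:E)%E.
Proof.
move=> mX lX lXY.
have iXX i j : P.-integrable setT (fun w => (X i w * X j w)%:E).
  exact: (integrable_gaussianM (mX i) (mX j) (lX i) (lX j)).
have iZ i j : P.-integrable setT (fun w => (c i * c j)%:E * (X i w * X j w)%:E)%E.
  exact: integrableZl.
transitivity (\int[P]_w (\sum_i \sum_j (c i * c j)%:E * (X i w * X j w)%:E))%E.
  apply: eq_integral => w _; rewrite expr2 mulr_suml -sumEFin; apply: eq_bigr => i _.
  rewrite mulr_sumr -sumEFin; apply: eq_bigr => j _.
  by rewrite -EFinM mulrACA.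
rewrite integral_sum//; last by move=> i; exact: integrable_sum.
rewrite mulr_sumr -sumEFin; apply: eq_bigr => i _.
rewrite integral_sum// (bigD1 i)//= big1 ?adde0.
  rewrite integralZl//; under eq_integral do rewrite -expr2.
  by rewrite (gaussian_moment2 (mX i) v0 (lX i)) -EFinM mulrC -expr2.
move=> j ji; rewrite integralZl//.
rewrite (gaussian_cross_moment (mX i) (mX j) (lX i) (lX j)) ?mule0// => A B mA mB.
by rewrite lXY// eq_sym.
Qed.

End GaussianQuadratic.

(** Stated for any commutative monoid in order to serve both sums of reals and products of extended
    reals. *)
Lemma big_pair_bool (V : Type) (idx : V) (op : Monoid.com_law idx) (I : finType)
    (F : I * bool -> V) :
  \big[op/idx]_i F i = \big[op/idx]_k op (F (k, true)) (F (k, false)).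
Proof.
rewrite (eq_bigr (fun i => F (i.1, i.2))); last by case.
rewrite -(pair_bigA _ (fun k b => F (k, b))) /=.
by apply: eq_bigr => k _; rewrite big_bool.
Qed.

(** * The complex Gaussian noise in real coordinates *)

Section ComplexGaussianNoise.
Context (R : realType) d (T : measurableType d) (P : probability T R).
Variables (K : nat) (n : T -> 'rV[R[i]]_K) (sigma : R).
Hypothesis nP : complex_normal P (sigma ^+ 2) n.

(** The power of a complex entry is shared equally between its real and imaginary parts. *)
Let v := sigma ^+ 2 / 2.
Let v0 : 0 <= v. Proof. by rewrite divr_ge0 ?sqr_ge0. Qed.

(** One family for all [2 * K] real coordinates, the boolean [true] marking imaginary parts. *)
Definition noise_coord (i : 'I_K * bool) (w : T) : R :=
  if i.2 then complex.Im (n w 0 i.1) else complex.Re (n w 0 i.1).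

Lemma measurable_noise_coord i : measurable_fun setT (noise_coord i).
Proof.
case: i => k b _ B mB; rewrite setTI; have [rn imn] := nP.1 k.
by case: b; [exact: imn|exact: rn].
Qed.

Lemma gaussian0_setT : gaussian0 v setT = 1%E.
Proof.
rewrite /gaussian0; case: ifP => _; first exact: diracT.
by rewrite /normal_prob integral_normal_pdf.
Qed.

Lemma noise_coord_law (C : 'I_K * bool -> set R) : (forall i, measurable (C i)) ->
  P [set w | forall i, C i (noise_coord i w)] =
  (\big[mule/1]_i gaussian0 v (C i))%E.
Proof.
move=> mC.
rewrite (_ : [set w | _] =
    rect_event n (fun k => C (k, false)) (fun k => C (k, true))).
  by rewrite nP.2// big_pair_bool; apply: eq_bigr => k _ /=; rewrite muleC.
apply/seteqP; split => w H.
  by move=> k; split; [exact: (H (k, false))|exact: (H (k, true))].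
by move=> [k []]; have [] := H k.
Qed.

Lemma noise_coord_law1 i A : measurable A ->
  P (noise_coord i @^-1` A) = gaussian0 v A.
Proof.
(* A marginal law is obtained from the joint law by putting [setT], of mass 1, in every other
   coordinate. *)
move=> mA; pose C l := if l == i then A else setT : set R.
have -> : noise_coord i @^-1` A = [set w | forall l, C l (noise_coord l w)].
  apply/seteqP; split => w /=; last by move=> /(_ i); rewrite /C eqxx.
  by move=> Aw l; rewrite /C; case: eqP => // ->.
rewrite noise_coord_law; last by move=> l; rewrite /C; case: ifP.
rewrite (bigD1 i)//= big1 ?mule1 /C ?eqxx// => l /negPf ->.
exact: gaussian0_setT.
Qed.

Lemma noise_coord_law2 i j A B : i != j -> measurable A -> measurable B ->
  P (noise_coord i @^-1` A `&` noise_coord j @^-1` B) =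
  (gaussian0 v A * gaussian0 v B)%E.
Proof.
move=> ij mA mB.
pose C l := if l == i then A else if l == j then B else setT : set R.
have -> : noise_coord i @^-1` A `&` noise_coord j @^-1` B =
    [set w | forall l, C l (noise_coord l w)].
  apply/seteqP; split => w /=.
    move=> [Aw Bw] l; rewrite /C; case: eqP => [->//|_]; by case: eqP => // ->.
  move=> H; split; first by have := H i; rewrite /C eqxx.
  by have := H j; rewrite /C eq_sym (negPf ij) eqxx.
rewrite noise_coord_law; last by move=> l; rewrite /C; do 2 case: ifP => //.
rewrite (bigD1 i)//= (bigD1 j)/=; last by rewrite eq_sym.
rewrite big1 ?mule1 /C ?eqxx; first by rewrite eq_sym (negPf ij).
by move=> l /andP[/negPf -> /negPf ->]; exact: gaussian0_setT.
Qed.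

Lemma noise_quadratic_mean m (A : 'M[R[i]]_(m, K)) :
  (\int[P]_w (sqnorm (A *m (n w)^T))%:E = (sigma ^+ 2 * frob A)%:E)%E.
Proof.
(* The families [c r] and [c' r] are the coefficients of the real and imaginary parts of entry [r]
   of the product, read off from [(a + ib)(x + iy) = (ax - by) + i(bx + ay)]. Their squares together
   sum to twice the squared norm of row [r], which cancels the factor 1/2 in [v]. *)
pose c r (i : 'I_K * bool) :=
  if i.2 then - complex.Im (A r i.1) else complex.Re (A r i.1).
pose c' r (i : 'I_K * bool) :=
  if i.2 then complex.Re (A r i.1) else complex.Im (A r i.1).
have sumb (f : 'I_K * bool -> R) : \sum_i f i = \sum_k (f (k, true) + f (k, false)).
  exact: big_pair_bool.
have sqE w : sqnorm (A *m (n w)^T) = \sum_r ((\sum_i c r i * noise_coord i w) ^+ 2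
    + (\sum_i c' r i * noise_coord i w) ^+ 2).
  rewrite sqnormE; apply: eq_bigr => r _; rewrite /sqmod mxE.
  congr (_ ^+ 2 + _ ^+ 2).
    rewrite (raddf_sum (@complex.Re R)) sumb; apply: eq_bigr => k _.
    rewrite mxE /c /noise_coord /=; case: (A r k) (n w 0 k) => a b [x y] /=; ring.
  rewrite (raddf_sum (@complex.Im R)) sumb; apply: eq_bigr => k _.
  rewrite mxE /c' /noise_coord /=; case: (A r k) (n w 0 k) => a b [x y] /=; ring.
have mlin (e : 'I_K * bool -> R) :
    measurable_fun setT (fun w => ((\sum_i e i * noise_coord i w) ^+ 2)%:E).
  apply/measurable_EFinP; apply: measurable_funX; apply: measurable_sum => i.
  by apply: measurable_funM => //; exact: measurable_noise_coord.
have lin2 e := gaussian_linear_form_moment2 v0 e measurable_noise_coord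
  noise_coord_law1 noise_coord_law2.
under eq_integral do rewrite sqE -sumEFin.
rewrite ge0_integral_sum//; last 2 first.
- by move=> r; under eq_fun do rewrite EFinD; exact: emeasurable_funD.
- by move=> r w _; rewrite lee_fin addr_ge0// sqr_ge0.
rewrite /frob mulr_sumr -sumEFin; apply: eq_bigr => r _.
under eq_integral do rewrite EFinD.
rewrite ge0_integralD//; last 2 first.
- by move=> w _; rewrite lee_fin sqr_ge0.
- by move=> w _; rewrite lee_fin sqr_ge0.
rewrite !lin2 -EFinD !sumb -mulrDr -big_split /= mulr_sumr mulr_sumr.
congr (_%:E); apply: eq_bigr => k _; rewrite /c /c' /v /sqmod /=.
by field.
Qed.

End ComplexGaussianNoise.

(** * Averaging over noise independent of the channel *)

Section NoisePower.
Context (R : realType) d (T : measurableType d) (P : probability T R).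
Variables (G : set (set T)) (K : nat) (n : T -> 'rV[R[i]]_K) (sigma : R).
Hypothesis G_sigma : sigma_algebra setT G.
Hypothesis G_sub : G `<=` measurable.
Hypothesis nP : complex_normal P (sigma ^+ 2) n.
Hypothesis nG : independent_of P G n.

Definition rect_events : set (set T) :=
  [set E | exists A B, [/\ forall k, measurable (A k), forall k, measurable (B k)
    & E = rect_event n A B]].

Lemma rect_events_setI_closed : setI_closed rect_events.
Proof.
move=> _ _ [A [B [mA mB ->]]] [A' [B' [mA' mB' ->]]].
exists (fun k => A k `&` A' k), (fun k => B k `&` B' k).
split => [k|k|]; [exact: measurableI|exact: measurableI|].
apply/seteqP; split => w /=.
  by move=> [H H'] k; have [? ?] := H k; have [? ?] := H' k.
by move=> H; split => k; have [[? ?] [? ?]] := H k.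
Qed.

Lemma rect_events_measurable : rect_events `<=` measurable.
Proof.
move=> _ [A [B [mA mB ->]]].
rewrite (_ : rect_event _ _ _ = \bigcap_(k in [set: 'I_K])
    ((fun w => complex.Re (n w 0 k)) @^-1` A k `&`
     (fun w => complex.Im (n w 0 k)) @^-1` B k)).
  apply: fin_bigcap_measurable => // k _; have [rn imn] := nP.1 k.
  by apply: measurableI; [exact: rn|exact: imn].
by apply/seteqP; split => w H k; [move=> _; exact: H|exact: (H k I)].
Qed.

Lemma rect_events_setT : rect_events setT.
Proof.
exists (fun=> setT), (fun=> setT); split => //.
by apply/seteqP; split => w // _ k.
Qed.

Let rect_sigma_sub : <<s rect_events >> `<=` measurable.
Proof.
by apply: smallest_sub; [exact: sigma_algebra_measurable|exact: rect_events_measurable].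
Qed.

(** For fixed [F], both sides are finite measures in [E]; they agree on the pi-system of rectangles,
    hence on the sigma-algebra that it generates. *)
Lemma independent_sigma F E : G F -> <<s rect_events >> E ->
  P (F `&` E) = (P F * P E)%E.
Proof.
move=> GF; have mF := G_sub GF.
have PF0 : 0 <= fine (P F) by rewrite fine_ge0.
pose c : {nonneg R} := NngNum PF0.
have -> : (P F * P E)%E = mscale c P E by rewrite /mscale /= fineK// fin_num_measure.
rewrite setIC -[LHS]/(mrestr P mF E).
apply: (@g_sigma_algebra_measure_unique _ _ _ _ rect_events_measurable (fun=> setT)).
- by move=> _; exact: rect_events_setT.
- by rewrite bigcup_const//; exists 0%N.
- exact: rect_events_setI_closed.
- move=> _ [A [B [mA mB ->]]].
  rewrite -[RHS]/((fine (P F))%:E * P _)%E fineK ?fin_num_measure//.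
  by rewrite /= /mrestr setIC nG.
- move=> k; rewrite /mrestr /= (le_lt_trans (probability_le1 P _)) ?ltry//.
  exact: measurableI.
Qed.

(* [T] itself, carrying in turn the sigma-algebras of the channel and of the
   noise: the two identity maps into these spaces are independent variables. *)
Local Notation TG := (g_sigma_algebraType G).
Local Notation TN := (g_sigma_algebraType rect_events).

Lemma measurable_wrtP (X : T -> R) :
  measurable_wrt G X -> measurable_fun setT (X : TG -> R).
Proof. by move=> mX _ B mB; rewrite setTI; apply: sub_sigma_algebra; exact: mX. Qed.

Lemma measurable_id_channel : measurable_fun setT (id : T -> TG).
Proof.
move=> _ B; rewrite setTI => mB; apply: G_sub.
by rewrite -(sigma_algebra_id G_sigma).
Qed.

Lemma measurable_id_noise : measurable_fun setT (id : T -> TN).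
Proof. by move=> _ B; rewrite setTI => mB; exact: rect_sigma_sub. Qed.

Lemma cmeasurable_noise k : cmeasurable (fun w : TN => n w 0 k).
Proof.
split => _ B mB; rewrite setTI; apply: sub_sigma_algebra.
  exists (fun l => if l == k then B else setT), (fun=> setT); split => //.
    by move=> l; case: ifP.
  apply/seteqP; split => w /=; last by move=> /(_ k)[]; rewrite eqxx.
  by move=> Bw l; split => //; case: eqP => // ->.
exists (fun=> setT), (fun l => if l == k then B else setT); split => //.
  by move=> l; case: ifP.
apply/seteqP; split => w /=; last by move=> /(_ k)[_]; rewrite eqxx.
by move=> Bw l; split => //; case: eqP => // ->.
Qed.

(** Tonelli freezes the channel, so that for each outcome the inner integral is that of a quadratic
    form with constant matrix [A w]; the weight [g] is later the inverse squared norm of the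
    channel. *)
Lemma noise_power m (A : T -> 'M[R[i]]_(m, K)) (g : T -> R) :
  (forall i j, cmeasurable (fun w : TG => A w i j)) ->
  measurable_fun setT (g : TG -> R) -> (forall w, 0 <= g w) ->
  (\int[P]_w (sqnorm (A w *m (n w)^T) * g w)%:E =
   \int[P]_w (sigma ^+ 2 * frob (A w) * g w)%:E)%E.
Proof.
move=> mA mg g0.
pose idG : {mfun T >-> TG} :=
  HB.pack (id : T -> TG) (isMeasurableFun.Build _ _ _ _ _ measurable_id_channel).
pose idN : {mfun T >-> TN} :=
  HB.pack (id : T -> TN) (isMeasurableFun.Build _ _ _ _ _ measurable_id_noise).
have ind B C : measurable B -> measurable C ->
    P (idG @^-1` B `&` idN @^-1` C) = (P (idG @^-1` B) * P (idN @^-1` C))%E.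
  move=> mB mC; apply: independent_sigma; last exact: mC.
  by have : <<s G >> B := mB; rewrite (sigma_algebra_id G_sigma).
(* The two roles of the outcome are separated: [u.1] drives the channel and [u.2] the noise. *)
pose h (u : TG * TN) : \bar R := (sqnorm (A u.1 *m (n u.2)^T) * g u.1)%:E.
have mh : measurable_fun setT h.
  apply/measurable_EFinP; apply: measurable_funM; last exact: measurableT_comp.
  apply: measurable_sqnorm => k; apply: cmeasurable_mulmx => [i j|i j].
    exact: (cmeasurable_comp (mA i j) measurable_fst).
  rewrite (ord1 j); under [X in cmeasurable X]funext do rewrite mxE.
  exact: (cmeasurable_comp (cmeasurable_noise i) measurable_snd).
have h0 u : (0 <= h u)%E by rewrite lee_fin mulr_ge0// sqnorm_ge0.
rewrite [LHS](@tonelli_independent _ _ _ P _ _ _ _ idG idN ind h mh h0).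
apply: eq_integral => w _; rewrite /h /=.
under eq_integral do rewrite mulrC EFinM.
rewrite ge0_integralZl//=.
- by rewrite (noise_quadratic_mean nP) -EFinM mulrC.
- apply/measurable_EFinP; apply: measurable_sqnorm => k.
  apply: cmeasurable_mulmx => [i j|i j]; first exact: cmeasurable_cst.
  rewrite (ord1 j); under [X in cmeasurable X]funext do rewrite mxE.
  exact: (cmeasurable_comp (cmeasurable_noise i) measurable_id_noise).
- by move=> w' _; rewrite lee_fin sqnorm_ge0.
- by rewrite lee_fin.
Qed.

End NoisePower.

(** * The exact decomposition of the prediction error and the two bounds *)

Theorem mainTheorem2 (R : realType) (d : measure_display)
    (T : measurableType d) (P : probability T R)
    (s : ofdm_system R) (NP : nat) (ch : T -> 'I_NP -> path_param R)
    (NL L M Ns : nat) (ts : nat -> R) (eta : R)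
    (sel : T -> 'I_Ns -> 'I_(Ndim s)) (z : T -> 'I_Ns -> 'I_M -> R[i])
    (theta phi : 'I_(Ndim s) -> R) (t Td sigma : R)
    (pilot : 'M[R[i]]_(Ns * M)) (noise : T -> 'rV[R[i]]_(Ns * M))
    (* the sigma-algebra of the channel and of what is extracted from it *)
    (G : set (set T))
    (G_sigma : sigma_algebra setT G) (G_sub : G `<=` measurable)
    (ch_meas : channel_measurable_wrt G ch)
    (sel_meas : forall j i, G [set w | sel w j = i])
    (z_meas : forall j m, cmeasurable_wrt G (fun w => z w j m))
    (ch_doppler : {ae P, forall w, doppler_reciprocity s (ch w)})
    (sel_inj : {ae P, forall w, injective (sel w)})
    (sel_smallest : {ae P, forall w,
       smallest_capturing (channel_u s (ch w)) ts NL eta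
         [set sel w j | j : 'I_Ns]%SET})
    (z_poles : {ae P, forall w, forall j,
       pencil_poles (channel_u s (ch w)) ts NL L (sel w j) (z w j)})
    (sel_angles : {ae P, forall w, forall j,
       column_angles (sel w j) (theta (sel w j)) (phi (sel w j))})
    (pilot_unitary : pilot \is unitarymx)
    (noise_law : complex_normal P (sigma ^+ 2) noise)
    (noise_indep : independent_of P G noise)
    (M_le_L : (M <= L)%N) (L_le : (L <= NL - L)%N) :
  let tp := t + Td in
  let hd w := channel_d s (ch w) tp in
  let hd1 w := recon1 (sel w) theta phi (hd w) in
  let hd2 w := recon2 (sel w) theta phi (z w) pilot tp (noise w) in
  let hrec w := hd1 w + hd2 w in
  let eps := ('E_P[fun w => (sqnorm (hd w - hrec w) / sqnorm (hd w))%R])%E in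
  let err1 := ('E_P[fun w => (sqnorm (hd w - hd1 w) / sqnorm (hd w))%R])%E in
  let noise_term := ('E_P[fun w => ((Ns * M)%:R * sigma ^+ 2 / sqnorm (hd w))%R])%E in
  (err1 - noise_term <= eps <= err1 + noise_term)%E.
Proof.
pose tp := t + Td.
pose hd w := channel_d s (ch w) tp.
pose hd1 w := recon1 (sel w) theta phi (hd w).
pose hd2 w := recon2 (sel w) theta phi (z w) pilot tp (noise w).
pose hrec w := hd1 w + hd2 w.
pose eps := ('E_P[fun w => (sqnorm (hd w - hrec w) / sqnorm (hd w))%R])%E.
pose err1 := ('E_P[fun w => (sqnorm (hd w - hd1 w) / sqnorm (hd w))%R])%E.
pose noise_term :=
  ('E_P[fun w => ((Ns * M)%:R * sigma ^+ 2 / sqnorm (hd w))%R])%E.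
suff : (err1 - noise_term <= eps <= err1 + noise_term)%E by [].
pose TG := g_sigma_algebraType G.
have mhd k : cmeasurable (fun w : TG => hd w k 0).
  apply: cmeasurable_channel_d => p; have [[? ? ?] [_ [? ?] _ ?]] := ch_meas p.
  by split; [..|split|]; exact: measurable_wrtP.
have msel j i : measurable ([set w | sel w j = i] : set TG).
  by apply: sub_sigma_algebra; exact: sel_meas.
have mz j m : cmeasurable (fun w : TG => z w j m).
  by have [? ?] := z_meas j m; split; exact: measurable_wrtP.
have mN : measurable_fun setT (fun w : TG => (sqnorm (hd w))^-1).
  by apply: (measurableT_comp (@measurable_inv R)); exact: measurable_sqnorm.
have N0 w : 0 <= (sqnorm (hd w))^-1 by rewrite invr_ge0 sqnorm_ge0.
have mA i j := cmeasurable_noise_gain theta phi msel mz pilot tp i j.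
have mres : measurable_fun setT (fun w : TG => sqnorm (hd w - hd1 w) / sqnorm (hd w)).
  apply: measurable_funM => //; apply: measurable_sqnorm => k.
  under [X in cmeasurable X]funext do rewrite mxE [X in _ + X]mxE.
  by apply: cmeasurableD => //; apply: cmeasurableN; exact: cmeasurable_recon1.
have midG := measurable_id_channel G_sigma G_sub.
(* Pythagoras holds for every outcome because [hd2 w] lies in the range of [D]. Where the channel
   vanishes, both sides are 0 by the convention [x / 0 = 0]. *)
have pyth w : sqnorm (hd w - hrec w) / sqnorm (hd w) =
    sqnorm (hd w - hd1 w) / sqnorm (hd w) + sqnorm (hd2 w) / sqnorm (hd w).
  rewrite -mulrDl /hrec opprD addrA (@sqnorm_orthogonalB _ _ _ (hd2 w))//.
  rewrite /hd2 /recon2 -2!mulmxA.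
  exact: residual_orthogonal.
have noiseE : (\int[P]_w (sqnorm (hd2 w) / sqnorm (hd w))%:E = noise_term)%E.
  rewrite /noise_term unlock -[RHS]/(\int[P]_w _)%E.
  have := noise_power G_sigma G_sub noise_law noise_indep mA mN N0.
  rewrite /hd2; under eq_integral do rewrite -recon2E.
  move=> ->; apply: eq_integral => w _.
  by rewrite frob_noise_gain// [sigma ^+ 2 * _]mulrC.
(* Additivity is used for nonnegative integrands, which covers infinite expectations. *)
have epsE : eps = (err1 + noise_term)%E.
  rewrite -noiseE /eps /err1 unlock.
  under eq_integral do rewrite pyth EFinD.
  rewrite ge0_integralD//.
  - by move=> w _; rewrite lee_fin mulr_ge0// sqnorm_ge0.
  - by apply/measurable_EFinP; exact: (measurableT_comp mres midG).
  - by move=> w _; rewrite lee_fin mulr_ge0// sqnorm_ge0.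
  - apply/measurable_EFinP; apply: measurable_funM.
      2: exact: (measurableT_comp mN midG).
    apply: measurable_sqnorm => k; rewrite /hd2.
    under [X in cmeasurable X]funext do rewrite recon2E.
    apply: cmeasurable_mulmx => [i j|i j].
      exact: (cmeasurable_comp (mA i j) midG).
    rewrite (ord1 j); under [X in cmeasurable X]funext do rewrite mxE.
    have midN := measurable_id_noise noise_law.
    exact: (cmeasurable_comp (cmeasurable_noise noise i) midN).
(* The upper bound is an equality, and monotonicity of addition in [\bar R] reduces the lower bound
   to [- noise_term <= noise_term]. *)
rewrite epsE lexx andbT; apply: leeD2l.
have n0 : (0 <= noise_term)%E.
  by rewrite -noiseE; apply: integral_ge0 => w _; rewrite lee_fin mulr_ge0// sqnorm_ge0.
by rewrite (le_trans _ n0)// leeNl oppe0.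
Qed.
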